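(* Let $\alpha\in(0,1)$ and let $S$ be the unilateral shift on $H^2(\mathbb{D})$, $(Sf)(z):=zf(z)$. For $C\in H^2(\mathbb{D})^*$ consider the resolvent condition $$(\ast)\qquad \sup_{\omega\in\mathbb{D}}(1-|\omega|^2)^{\frac{1-\alpha}{2}}\|C(I-\bar\omega S)^{-1}\|_{H^2(\mathbb{D})^*}<\infty .$$ Then: (i) If $(\ast)$ holds for $C\in H^2(\mathbb{D})^*$, then $C$ is discrete $\beta$-admissible for $S$ for every $\beta\in[0,\alpha)$. (ii) There exists $C\in H^2(\mathbb{D})^*$ which satisfies $(\ast)$ but which is not discrete $\alpha$-admissible for $S$.
   Context: $\mathbb{D}$ is the open unit disc and $H^2(\mathbb{D})$ the Hardy space. For $\gamma\in(-1,1)$, a Hilbert space $X$, $A\in\mathcal{L}(X)$ with $\sigma(A)\subset\overline{\mathbb{D}}$ and $C\in X^*$, the functional $C$ is called discrete $\gamma$-admissible for $A$ if there is $M>0$ such that $\sum_{n=0}^\infty(1+n)^\gamma|CA^nx|^2\le M\|x\|_X^2$ for all $x\in X$. *)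

(* Defs.v *)
From Stdlib Require Import Reals Lra Lia Psatz.
From Stdlib Require Import FunctionalExtensionality ProofIrrelevance ClassicalEpsilon.
From Coquelicot Require Import Coquelicot.

Set Implicit Arguments.
Unset Strict Implicit.
Unset Printing Implicit Defensive.
Open Scope R_scope.

(* Elements of L(X) and of X^* are functions satisfying Coquelicot's
   [is_linear], which includes boundedness. *)

(* Norm of X^*. Only meaningful for a bounded functional: [real] sends an
   infinite supremum to 0. *)
Definition dual_norm (X : NormedModule C_AbsRing) (c : X -> C) : R :=
  real (Lub_Rbar (fun r => exists x : X, norm x <= 1 /\ r = Cmod (c x))).

Definition is_inverse (X : NormedModule C_AbsRing) (T B : X -> X) : Prop :=
  is_linear B /\ (forall x, B (T x) = x) /\ (forall x, T (B x) = x).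

(* T^{-1}, an arbitrary operator when T has no bounded inverse. *)
Definition op_inv (X : NormedModule C_AbsRing) (T : X -> X) : X -> X :=
  epsilon (inhabits (fun x : X => x)) (is_inverse T).

Definition in_spectrum (X : NormedModule C_AbsRing) (A : X -> X) (lambda : C) : Prop :=
  ~ exists B, is_inverse (fun x => minus (scal lambda x) (A x)) B.

(* To be read for A in L(X) with spectrum in the closed unit disc and C in X^*. *)
Definition discrete_admissible (X : NormedModule C_AbsRing) (gamma : R) (A : X -> X) (c : X -> C) : Prop :=
  exists M : R, 0 < M /\ forall x : X,
    ex_series (fun n => Rpower (1 + INR n) gamma * Cmod (c (Nat.iter n A x)) ^ 2) /\
    Series (fun n => Rpower (1 + INR n) gamma * Cmod (c (Nat.iter n A x)) ^ 2)
      <= M * norm x ^ 2.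

Definition disc_resolvent (X : NormedModule C_AbsRing) (A : X -> X) (w : C) : X -> X :=
  op_inv (fun x => minus x (scal (Cconj w) (A x))).

Definition resolvent_condition (X : NormedModule C_AbsRing) (alpha : R) (A : X -> X) (c : X -> C) : Prop :=
  Rbar_lt
    (Lub_Rbar (fun r => exists w : C, Cmod w < 1 /\
       r = Rpower (1 - Cmod w ^ 2) ((1 - alpha) / 2) *
           dual_norm (fun x => c (disc_resolvent A w x))))
    p_infty.

Lemma linear_zero (X : NormedModule C_AbsRing) (c : X -> C) : is_linear c -> c zero = 0%C.
Proof.
intros Hc. pose proof (linear_scal c Hc (zero : C_AbsRing) (zero : X)) as E.
refine (eq_trans (f_equal c (eq_sym _)) (eq_trans E (Cmult_0_l _))).
exact (scal_zero_l (K := C_AbsRing) (V := X) zero).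
Qed.

Lemma dual_norm_is_lub (X : NormedModule C_AbsRing) (c : X -> C) : is_linear c ->
  is_lub_Rbar (fun r => exists x : X, norm x <= 1 /\ r = Cmod (c x))
    (dual_norm c).
Proof.
intros Hc. unfold dual_norm.
destruct (linear_norm c Hc) as [M [HM HcM]].
set (E := fun r => _). pose proof (Lub_Rbar_correct E) as HL.
replace (Finite (real (Lub_Rbar E))) with (Lub_Rbar E); [exact HL|].
destruct (Lub_Rbar E) as [r| |]; [reflexivity| |].
- exfalso. apply (proj2 HL (Finite M)).
  intros r [x [Hx ->]]. change (Cmod (c x) <= M).
  apply Rle_trans with (1 := HcM x). nra.
- exfalso. apply (proj1 HL 0). exists zero. split.
  + rewrite norm_zero; lra.
  + rewrite (linear_zero Hc), Cmod_0. reflexivity.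
Qed.

Lemma op_inv_correct (X : NormedModule C_AbsRing) (T B : X -> X) : is_inverse T B -> op_inv T = B.
Proof.
intros HB. assert (H : is_inverse T (op_inv T)).
{ unfold op_inv. apply epsilon_spec. exists B; exact HB. }
apply functional_extensionality; intros x.
rewrite <- (proj2 (proj2 HB) x) at 1. apply (proj1 (proj2 H)).
Qed.

Definition square_summable (a : nat -> C) : Prop :=
  ex_series (fun n => Cmod (a n) ^ 2).

Definition l2_norm (a : nat -> C) : R := sqrt (Series (fun n => Cmod (a n) ^ 2)).

Lemma ex_series_nonneg (u : nat -> R) (M : R) :
  (forall n, 0 <= u n) -> (forall n, sum_n u n <= M) ->
  ex_series u /\ Series u <= M.
Proof.
intros Hu HM.
assert (E : ex_finite_lim_seq (sum_n u)).
{ apply ex_finite_lim_seq_incr with M; [|exact HM].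
  intros n. rewrite sum_Sn. unfold plus; simpl. specialize (Hu (S n)); lra. }
destruct E as [l Hl].
assert (Hs : is_series u l) by exact Hl.
split; [exists l; exact Hs|].
rewrite (is_series_unique _ _ Hs).
exact (is_lim_seq_le _ _ l M HM Hl (is_lim_seq_const M)).
Qed.

Lemma sum_n_le_Series (u : nat -> R) (n : nat) :
  (forall n, 0 <= u n) -> ex_series u -> sum_n u n <= Series u.
Proof.
intros Hu Hex.
assert (Hl : is_lim_seq (sum_n u) (Series u)) by exact (Series_correct _ Hex).
apply (is_lim_seq_incr_compare _ _ Hl).
intros k. rewrite sum_Sn. unfold plus; simpl. specialize (Hu (S k)); lra.
Qed.

Lemma term_le_Series (u : nat -> R) (n : nat) :
  (forall n, 0 <= u n) -> ex_series u -> u n <= Series u.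
Proof.
intros Hu Hex. apply Rle_trans with (2 := @sum_n_le_Series u n Hu Hex).
destruct n as [|n]; [rewrite sum_O; lra|].
rewrite sum_Sn. unfold plus; simpl.
assert (0 <= sum_n u n); [|lra].
induction n as [|n IH]; [rewrite sum_O; auto|].
rewrite sum_Sn. unfold plus; simpl. specialize (Hu (S n)); lra.
Qed.

Lemma square_nonneg (a : nat -> C) n : 0 <= Cmod (a n) ^ 2.
Proof. apply pow2_ge_0. Qed.

Lemma Series_square_nonneg (a : nat -> C) :
  square_summable a -> 0 <= Series (fun n => Cmod (a n) ^ 2).
Proof.
intros Ha. apply Rle_trans with (1 := square_nonneg a 0).
exact (@term_le_Series (fun n => Cmod (a n) ^ 2) 0 (square_nonneg a) Ha).
Qed.

Lemma l2_norm_sqr (a : nat -> C) :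
  square_summable a -> l2_norm a ^ 2 = Series (fun n => Cmod (a n) ^ 2).
Proof. intros Ha. apply pow2_sqrt, Series_square_nonneg, Ha. Qed.

Lemma Cmod_le_l2_norm (a : nat -> C) n : square_summable a -> Cmod (a n) <= l2_norm a.
Proof.
intros Ha. unfold l2_norm. rewrite <- (sqrt_pow2 (Cmod (a n))) by apply Cmod_ge_0.
apply sqrt_le_1_alt.
exact (@term_le_Series (fun n => Cmod (a n) ^ 2) n (square_nonneg a) Ha).
Qed.

Lemma Cmod_plus_sqr (x y : C) (t : R) : 0 < t ->
  Cmod (x + y) ^ 2 <= (1 + t) * Cmod x ^ 2 + (1 + / t) * Cmod y ^ 2.
Proof.
intros Ht. pose proof (Cmod_triangle x y) as H.
pose proof (Cmod_ge_0 (x + y)). pose proof (Cmod_ge_0 x). pose proof (Cmod_ge_0 y).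
apply Rle_trans with ((Cmod x + Cmod y) ^ 2); [apply pow_incr; lra|].
assert (E : (1 + t) * Cmod x ^ 2 + (1 + / t) * Cmod y ^ 2 - (Cmod x + Cmod y) ^ 2
  = / t * (t * Cmod x - Cmod y) ^ 2) by (field; lra).
assert (0 <= / t * (t * Cmod x - Cmod y) ^ 2); [|lra].
apply Rmult_le_pos; [left; apply Rinv_0_lt_compat, Ht | apply pow2_ge_0].
Qed.

Lemma square_summable_plus (a b : nat -> C) :
  square_summable a -> square_summable b ->
  square_summable (fun n => (a n + b n)%C).
Proof.
intros Ha Hb.
apply (ex_series_le (V := R_CompleteNormedModule) _
  (fun n => (1 + 1) * Cmod (a n) ^ 2 + (1 + / 1) * Cmod (b n) ^ 2)).
- intros n. unfold norm; simpl. unfold abs; simpl.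
  rewrite Rabs_right; [|apply Rle_ge, (square_nonneg (fun n => (a n + b n)%C))].
  apply (@Cmod_plus_sqr (a n) (b n) 1). lra.
- apply (ex_series_plus (V := R_NormedModule));
  apply (ex_series_scal (V := R_NormedModule)); assumption.
Qed.

Lemma l2_norm_triangle (a b : nat -> C) :
  square_summable a -> square_summable b ->
  l2_norm (fun n => (a n + b n)%C) <= l2_norm a + l2_norm b.
Proof.
intros Ha Hb. apply le_epsilon. intros eps He.
pose proof (sqrt_pos (Series (fun n => Cmod (a n) ^ 2))) as PA.
pose proof (sqrt_pos (Series (fun n => Cmod (b n) ^ 2))) as PB.
fold (l2_norm a) in PA. fold (l2_norm b) in PB.
pose proof (l2_norm_sqr Ha) as EA. pose proof (l2_norm_sqr Hb) as EB.
set (A := l2_norm a + eps / 2). set (B := l2_norm b + eps / 2).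
assert (A0 : 0 < A) by (unfold A; lra). assert (B0 : 0 < B) by (unfold B; lra).
replace (l2_norm a + l2_norm b + eps) with (A + B) by (unfold A, B; lra).
unfold l2_norm at 1. rewrite <- (sqrt_pow2 (A + B)) by lra.
apply sqrt_le_1_alt.
set (t := B / A). assert (Ht : 0 < t) by (apply Rdiv_lt_0_compat; assumption).
assert (Ha' : ex_series (fun n => (1 + t) * Cmod (a n) ^ 2))
  by (apply (ex_series_scal (V := R_NormedModule)); exact Ha).
assert (Hb' : ex_series (fun n => (1 + / t) * Cmod (b n) ^ 2))
  by (apply (ex_series_scal (V := R_NormedModule)); exact Hb).
apply Rle_trans with
  (Series (fun n => (1 + t) * Cmod (a n) ^ 2 + (1 + / t) * Cmod (b n) ^ 2)).
- apply Series_le.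
  + intros n. split; [apply (square_nonneg (fun n => (a n + b n)%C))|].
    apply Cmod_plus_sqr, Ht.
  + apply (ex_series_plus (V := R_NormedModule)); assumption.
- rewrite Series_plus by assumption. rewrite !Series_scal_l, <- EA, <- EB.
  assert (l2_norm a ^ 2 <= A ^ 2) by (apply pow_incr; unfold A; lra).
  assert (l2_norm b ^ 2 <= B ^ 2) by (apply pow_incr; unfold B; lra).
  assert (0 < / t) by (apply Rinv_0_lt_compat, Ht).
  apply Rle_trans with ((1 + t) * A ^ 2 + (1 + / t) * B ^ 2); [nra|].
  right. unfold t. field. lra.
Qed.

Lemma square_summable_scal (k : C) (a : nat -> C) :
  square_summable a -> square_summable (fun n => (k * a n)%C).
Proof.
intros Ha. apply (ex_series_ext (V := R_NormedModule) (fun n => Cmod k ^ 2 * Cmod (a n) ^ 2)).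
- intros n. change (Cmod k ^ 2 * Cmod (a n) ^ 2 = Cmod (k * a n) ^ 2).
  rewrite Cmod_mult. ring.
- apply (ex_series_scal (V := R_NormedModule)). exact Ha.
Qed.

Lemma l2_norm_scal (k : C) (a : nat -> C) :
  l2_norm (fun n => (k * a n)%C) = Cmod k * l2_norm a.
Proof.
unfold l2_norm.
rewrite (Series_ext _ (fun n => Cmod k ^ 2 * Cmod (a n) ^ 2)).
- rewrite Series_scal_l, sqrt_mult_alt by apply pow2_ge_0.
  rewrite sqrt_pow2 by apply Cmod_ge_0. reflexivity.
- intros n. rewrite Cmod_mult. ring.
Qed.

Lemma square_summable_shift (a : nat -> C) :
  square_summable a -> square_summable (PS_incr_1 (V := C_NormedModule) a).
Proof. intros Ha. apply (proj2 (ex_series_incr_1 (V := R_NormedModule) _)). exact Ha. Qed.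

Lemma l2_norm_shift (a : nat -> C) :
  square_summable a -> l2_norm (PS_incr_1 (V := C_NormedModule) a) = l2_norm a.
Proof.
intros Ha. unfold l2_norm. f_equal. rewrite Series_incr_1.
- change (Cmod (RtoC 0) ^ 2 + Series (fun n => Cmod (a n) ^ 2)
    = Series (fun n => Cmod (a n) ^ 2)).
  rewrite Cmod_0. ring.
- apply square_summable_shift, Ha.
Qed.

Lemma is_pseries_value_unique (a : nat -> C) (z l1 l2 : C) :
  is_pseries (V := C_NormedModule) a z l1 ->
  is_pseries (V := C_NormedModule) a z l2 -> l1 = l2.
Proof.
exact (filterlim_locally_unique
  (sum_n (fun k => scal (pow_n (z : C_AbsRing) k) (a k : C_NormedModule))) l1 l2).
Qed.

Lemma Cmod_pow_n_le (z : C) k : Cmod (pow_n (K := C_Ring) z k) <= Cmod z ^ k.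
Proof. exact (@abs_pow_n C_AbsRing z k). Qed.

Lemma pseries_bounded_le (a : nat -> C) (B : R) (z l : C) :
  (forall n, Cmod (a n) <= B) -> Cmod z < 1 ->
  is_pseries (V := C_NormedModule) a z l -> Cmod l <= B * / (1 - Cmod z).
Proof.
intros HB Hz Hl.
assert (HB0 : 0 <= B) by (apply Rle_trans with (2 := HB 0%nat); apply Cmod_ge_0).
pose proof (Cmod_ge_0 z) as Hz0.
assert (G : is_series (fun n => B * Cmod z ^ n) (B * / (1 - Cmod z))).
{ apply (is_series_scal (V := R_NormedModule)). apply is_series_geom.
  rewrite Rabs_right; lra. }
set (u := fun k => scal (pow_n (z : C_AbsRing) k) (a k : C_NormedModule)).
assert (L : is_lim_seq (fun n => norm (sum_n u n)) (norm (l : C_NormedModule))).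
{ exact (filterlim_comp _ _ _ _ _ _ _ _ Hl (filterlim_norm (l : C_NormedModule))). }
refine (is_lim_seq_le _ _ (Finite (Cmod l)) (Finite (B * / (1 - Cmod z))) _ L G).
intros n. induction n as [|n IH].
- rewrite !sum_O. unfold u. simpl pow_n. rewrite scal_one.
  rewrite pow_O, Rmult_1_r. apply HB.
- rewrite !sum_Sn. apply Rle_trans with (1 := norm_triangle _ _).
  apply Rplus_le_compat; [exact IH|].
  change (Cmod (pow_n (K := C_Ring) z (S n) * a (S n)) <= B * Cmod z ^ S n).
  rewrite Cmod_mult, Rmult_comm.
  apply Rmult_le_compat; try apply Cmod_ge_0; [apply HB|apply Cmod_pow_n_le].
Qed.

Lemma ex_pseries_bounded (a : nat -> C) (B : R) (z : C) :
  (forall n, Cmod (a n) <= B) -> Cmod z < 1 ->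
  exists l : C, is_pseries (V := C_NormedModule) a z l.
Proof.
intros HB Hz. pose proof (Cmod_ge_0 z) as Hz0.
apply (ex_series_le (V := C_CompleteNormedModule) _ (fun n => B * Cmod z ^ n)).
- intros n. change (Cmod (pow_n (K := C_Ring) z n * a n) <= B * Cmod z ^ n).
  rewrite Cmod_mult, Rmult_comm.
  apply Rmult_le_compat; try apply Cmod_ge_0; [apply HB|apply Cmod_pow_n_le].
- apply (ex_series_scal (V := R_NormedModule)). apply ex_series_geom.
  rewrite Rabs_right; lra.
Qed.

Lemma pseries_zero_coef (n : nat) : forall (a : nat -> C) (B : R),
  (forall k, Cmod (a k) <= B) ->
  (forall x : R, 0 < x < 1 -> is_pseries (V := C_NormedModule) a (RtoC x) (RtoC 0)) ->
  a n = RtoC 0.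
Proof.
assert (H0 : forall (a : nat -> C) (B : R),
  (forall k, Cmod (a k) <= B) ->
  (forall x : R, 0 < x < 1 -> is_pseries (V := C_NormedModule) a (RtoC x) (RtoC 0)) ->
  a 0%nat = RtoC 0 /\ (forall x : R, 0 < x < 1 ->
    is_pseries (V := C_NormedModule) (PS_decr_1 (V := C_NormedModule) a)
     (RtoC x) (RtoC 0))).
{ intros a B HB Ha.
  assert (HB0 : 0 <= B) by (apply Rle_trans with (2 := HB 0%nat); apply Cmod_ge_0).
  assert (D : forall x : R, 0 < x < 1 ->
    is_pseries (V := C_NormedModule) (PS_decr_1 (V := C_NormedModule) a)
     (RtoC x) (RtoC (/ x) * - a 0%nat)%C).
  { intros x Hx.
    assert (E : mult (K := C_AbsRing) (RtoC (/ x)) (RtoC x) = one).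
    { change ((RtoC (/ x) * RtoC x)%C = RtoC 1). rewrite <- RtoC_mult. f_equal.
      field. lra. }
    pose proof (@is_pseries_decr_1 C_AbsRing C_NormedModule a _ _ _ E (Ha x Hx)) as P.
    match type of P with is_pseries _ _ ?l =>
      replace (RtoC (/ x) * - a 0%nat)%C with l; [exact P|] end.
    change ((RtoC (/ x) * (RtoC 0 + - a 0%nat))%C = (RtoC (/ x) * - a 0%nat)%C).
    ring. }
  assert (Z : a 0%nat = RtoC 0).
  { apply Cmod_eq_0. apply Rle_antisym; [|apply Cmod_ge_0].
    apply le_epsilon. intros e He. rewrite Rplus_0_l.
    set (x := Rmin (/ 2) (e / (2 * (B + 1)))).
    assert (X1 : x <= / 2) by apply Rmin_l.
    assert (X2 : x <= e / (2 * (B + 1))) by apply Rmin_r.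
    assert (X0 : 0 < x).
    { apply Rmin_glb_lt; [lra|]. apply Rdiv_lt_0_compat; lra. }
    assert (Hx : 0 < x < 1) by lra.
    assert (M : Cmod (RtoC x) = x) by (rewrite Cmod_R, Rabs_right; lra).
    assert (HB' : forall k, Cmod (PS_decr_1 (V := C_NormedModule) a k) <= B)
      by (intros k; apply HB).
    pose proof (@pseries_bounded_le _ B (RtoC x) _ HB' ltac:(rewrite M; lra) (D x Hx)) as Q.
    rewrite Cmod_mult, Cmod_opp, M, Cmod_R, Rabs_right in Q
      by (left; apply Rinv_0_lt_compat, X0).
    assert (Q2 : Cmod (a 0%nat) <= x * (B * / (1 - x))).
    { apply (Rmult_le_compat_l x) in Q; [|lra]. rewrite <- Rmult_assoc, Rinv_r, Rmult_1_l in Q; lra. }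
    assert (I : / (1 - x) <= 2).
    { rewrite <- (Rinv_inv 2). apply Rinv_le_contravar; lra. }
    assert (x * (2 * (B + 1)) <= e).
    { apply (Rmult_le_compat_r (2 * (B + 1))) in X2; [|lra].
      unfold Rdiv in X2. rewrite Rmult_assoc, Rinv_l, Rmult_1_r in X2; lra. }
    assert (B * / (1 - x) <= B * 2) by (apply Rmult_le_compat_l; lra).
    nra. }
  split; [exact Z|]. intros x Hx. pose proof (D x Hx) as P. rewrite Z in P.
  replace (RtoC (/ x) * - RtoC 0)%C with (RtoC 0) in P by ring. exact P. }
induction n as [|n IH]; intros a B HB Ha.
- exact (proj1 (H0 a B HB Ha)).
- apply (IH (PS_decr_1 (V := C_NormedModule) a) B).
  + intros k; apply HB.
  + exact (proj2 (H0 a B HB Ha)).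
Qed.

Definition disc : Type := {z : C | Cmod z < 1}.

Definition has_coef (a : nat -> C) (f : disc -> C) : Prop :=
  square_summable a /\
  forall z : disc, is_pseries (V := C_NormedModule) a (proj1_sig z) (f z).

(* H^2(D): the analytic functions on D whose Taylor coefficients are square
   summable, with the l^2 norm of the coefficients as norm. *)
Record H2_space : Type := mkH2 {
  H2_fun :> disc -> C;
  H2_prop : exists a, has_coef a H2_fun
}.

Definition H2_coef (f : H2_space) : nat -> C :=
  proj1_sig (constructive_indefinite_description _ (H2_prop f)).

Lemma H2_coefP (f : H2_space) : has_coef (H2_coef f) f.
Proof. exact (proj2_sig (constructive_indefinite_description _ (H2_prop f))). Qed.

Lemma H2_ext (f g : H2_space) : (forall z, f z = g z) -> f = g.
Proof.
destruct f as [f Hf], g as [g Hg]; simpl; intros E.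
assert (f = g) by (apply functional_extensionality; exact E). subst g.
f_equal. apply proof_irrelevance.
Qed.

Lemma has_coef_plus a b f g : has_coef a f -> has_coef b g ->
  has_coef (fun n => (a n + b n)%C) (fun z => (f z + g z)%C).
Proof.
intros [Ha Pa] [Hb Pb]. split; [apply square_summable_plus; assumption|].
intros z. exact (is_pseries_plus (V := C_NormedModule) _ _ _ _ _ (Pa z) (Pb z)).
Qed.

Lemma has_coef_scal k a f : has_coef a f ->
  has_coef (fun n => (k * a n)%C) (fun z => (k * f z)%C).
Proof.
intros [Ha Pa]. split; [apply square_summable_scal, Ha|].
intros z. exact (is_pseries_scal (V := C_NormedModule) (k : C_AbsRing) _ _ _ (Cmult_comm _ _) (Pa z)).
Qed.

Lemma has_coef_shift a f : has_coef a f ->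
  has_coef (PS_incr_1 (V := C_NormedModule) a) (fun z => (proj1_sig z * f z)%C).
Proof.
intros [Ha Pa]. split; [apply square_summable_shift, Ha|].
intros z. exact (is_pseries_incr_1 (V := C_NormedModule) _ _ _ (Pa z)).
Qed.

Lemma has_coef_zero : has_coef (fun _ => RtoC 0) (fun _ => RtoC 0).
Proof.
assert (S0 : square_summable (fun _ => RtoC 0)).
{ apply (ex_series_ext (V := R_NormedModule) (fun n => 0 * (/ 2) ^ n)).
  - intros n. change (0 * (/ 2) ^ n = Cmod (RtoC 0) ^ 2). rewrite Cmod_0. ring.
  - apply (ex_series_scal (V := R_NormedModule)). apply ex_series_geom.
    rewrite Rabs_right; lra. }
split; [exact S0|]. intros z.
destruct (@ex_pseries_bounded (fun _ => RtoC 0) 0 (proj1_sig z)) as [l Hl].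
- intros _. rewrite Cmod_0. lra.
- exact (proj2_sig z).
- assert (E : l = RtoC 0); [|rewrite E in Hl; exact Hl].
  apply Cmod_eq_0. apply Rle_antisym; [|apply Cmod_ge_0].
  rewrite <- (Rmult_0_l (/ (1 - Cmod (proj1_sig z)))).
  apply (@pseries_bounded_le (fun _ => RtoC 0) 0 (proj1_sig z)); auto.
  + intros _. rewrite Cmod_0. lra.
  + exact (proj2_sig z).
Qed.

Lemma has_coef_unique a b f : has_coef a f -> has_coef b f -> forall n, a n = b n.
Proof.
intros Ha Hb.
pose proof (has_coef_plus Ha (has_coef_scal (RtoC (-1)) Hb)) as [Hs Hp].
set (d := fun n => (a n + RtoC (-1) * b n)%C) in *.
intros n.
assert (E : d n = RtoC 0).
{ apply (@pseries_zero_coef n d (l2_norm d)).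
  - intros k. apply Cmod_le_l2_norm, Hs.
  - intros x Hx. assert (Hx' : Cmod (RtoC x) < 1) by (rewrite Cmod_R, Rabs_right; lra).
    pose proof (Hp (exist _ (RtoC x) Hx')) as P. simpl in P.
    replace (RtoC 0) with
      (f (exist _ (RtoC x) Hx') + RtoC (-1) * f (exist _ (RtoC x) Hx'))%C; [exact P|].
    ring. }
unfold d in E. replace (a n) with ((a n + RtoC (-1) * b n) + b n)%C by ring.
rewrite E. ring.
Qed.

Lemma H2_coef_unique (f : H2_space) a : has_coef a f -> H2_coef f = a.
Proof.
intros Ha. apply functional_extensionality.
exact (has_coef_unique (H2_coefP f) Ha).
Qed.

Definition H2_plus (f g : H2_space) : H2_space :=
  @mkH2 (fun z => (f z + g z)%C) (ex_intro (fun a => has_coef a _) _ (has_coef_plus (H2_coefP f) (H2_coefP g))).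

Definition H2_scal (k : C) (f : H2_space) : H2_space :=
  @mkH2 (fun z => (k * f z)%C) (ex_intro (fun a => has_coef a _) _ (has_coef_scal k (H2_coefP f))).

Definition H2_opp (f : H2_space) : H2_space := H2_scal (RtoC (-1)) f.

Definition H2_zero : H2_space := @mkH2 (fun _ => RtoC 0) (ex_intro (fun a => has_coef a _) _ has_coef_zero).

Definition H2_norm (f : H2_space) : R := l2_norm (H2_coef f).

Lemma H2_coef_plus f g : H2_coef (H2_plus f g) = fun n => (H2_coef f n + H2_coef g n)%C.
Proof. apply H2_coef_unique. exact (has_coef_plus (H2_coefP f) (H2_coefP g)). Qed.

Lemma H2_coef_scal k f : H2_coef (H2_scal k f) = fun n => (k * H2_coef f n)%C.
Proof. apply H2_coef_unique. exact (has_coef_scal k (H2_coefP f)). Qed.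

Lemma H2_coef_zero : H2_coef H2_zero = fun _ => RtoC 0.
Proof. apply H2_coef_unique. exact has_coef_zero. Qed.

Lemma H2_norm_triangle f g : H2_norm (H2_plus f g) <= H2_norm f + H2_norm g.
Proof.
unfold H2_norm. rewrite H2_coef_plus.
apply l2_norm_triangle; [exact (proj1 (H2_coefP f)) | exact (proj1 (H2_coefP g))].
Qed.

Lemma H2_norm_scal k f : H2_norm (H2_scal k f) = Cmod k * H2_norm f.
Proof. unfold H2_norm. rewrite H2_coef_scal. apply l2_norm_scal. Qed.

Lemma H2_norm_eq_0 f : H2_norm f = 0 -> f = H2_zero.
Proof.
intros E. apply H2_ext. intros z.
assert (Z : H2_coef f = fun _ => RtoC 0).
{ apply functional_extensionality; intros n. apply Cmod_eq_0.
  apply Rle_antisym; [|apply Cmod_ge_0]. rewrite <- E.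
  apply Cmod_le_l2_norm. exact (proj1 (H2_coefP f)). }
pose proof (proj2 (H2_coefP f) z) as P. rewrite Z in P.
exact (is_pseries_value_unique P (proj2 has_coef_zero z)).
Qed.

Lemma H2_plus_comm f g : H2_plus f g = H2_plus g f.
Proof. apply H2_ext; intros z; simpl; ring. Qed.
Lemma H2_plus_assoc f g h : H2_plus f (H2_plus g h) = H2_plus (H2_plus f g) h.
Proof. apply H2_ext; intros z; simpl; ring. Qed.
Lemma H2_plus_zero f : H2_plus f H2_zero = f.
Proof. apply H2_ext; intros z; simpl; ring. Qed.
Lemma H2_plus_opp f : H2_plus f (H2_opp f) = H2_zero.
Proof. apply H2_ext; intros z; simpl; ring. Qed.

Definition H2_AbelianMonoid_mixin :=
  AbelianMonoid.Mixin H2_space H2_plus H2_zero H2_plus_comm H2_plus_assoc H2_plus_zero.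
Canonical H2_AbelianMonoid := AbelianMonoid.Pack H2_space H2_AbelianMonoid_mixin H2_space.
Definition H2_AbelianGroup_mixin := AbelianGroup.Mixin H2_AbelianMonoid H2_opp H2_plus_opp.
Canonical H2_AbelianGroup :=
  AbelianGroup.Pack H2_space (AbelianGroup.Class _ _ H2_AbelianGroup_mixin) H2_space.

Lemma H2_scal_assoc (x y : C_AbsRing) f : H2_scal x (H2_scal y f) = H2_scal (mult x y) f.
Proof. apply H2_ext; intros z. change ((x * (y * f z))%C = (x * y * f z)%C). ring. Qed.
Lemma H2_scal_one f : H2_scal (one : C_AbsRing) f = f.
Proof. apply H2_ext; intros z. exact (Cmult_1_l _). Qed.
Lemma H2_scal_distr_l (x : C_AbsRing) f g :
  H2_scal x (H2_plus f g) = H2_plus (H2_scal x f) (H2_scal x g).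
Proof. apply H2_ext; intros z. exact (Cmult_plus_distr_l _ _ _). Qed.
Lemma H2_scal_distr_r (x y : C_AbsRing) f :
  H2_scal (plus x y) f = H2_plus (H2_scal x f) (H2_scal y f).
Proof. apply H2_ext; intros z. exact (Cmult_plus_distr_r _ _ _). Qed.

Definition H2_ModuleSpace_mixin :=
  ModuleSpace.Mixin C_AbsRing H2_AbelianGroup H2_scal
    H2_scal_assoc H2_scal_one H2_scal_distr_l H2_scal_distr_r.
Canonical H2_ModuleSpace :=
  ModuleSpace.Pack C_AbsRing H2_space
    (ModuleSpace.Class _ _ _ H2_ModuleSpace_mixin) H2_space.

Definition H2_ball (f : H2_space) (e : R) (g : H2_space) : Prop :=
  H2_norm (minus g f) < e.

Lemma H2_ball_center f (e : posreal) : H2_ball f e f.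
Proof.
unfold H2_ball. rewrite minus_eq_zero.
change (H2_norm H2_zero < e). unfold H2_norm, l2_norm. rewrite H2_coef_zero.
rewrite (Series_ext _ (fun _ => 0 * 0)) by (intros n; rewrite Cmod_0; ring).
rewrite Series_scal_l, Rmult_0_l, sqrt_0. apply cond_pos.
Qed.
Lemma H2_ball_sym f g (e : R) : H2_ball f e g -> H2_ball g e f.
Proof.
unfold H2_ball. intros H.
replace (minus f g) with (H2_scal (RtoC (-1)) (minus g f)).
- rewrite H2_norm_scal, Cmod_R, Rabs_left by lra.
  replace (- -1) with 1 by ring. rewrite Rmult_1_l. exact H.
- apply H2_ext; intros z.
  change ((RtoC (-1) * (g z + RtoC (-1) * f z))%C = (f z + RtoC (-1) * g z)%C).
  replace (RtoC (-1)) with (- RtoC 1)%C by (rewrite <- RtoC_opp; reflexivity). ring.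
Qed.
Lemma H2_ball_triangle f g h (e1 e2 : R) :
  H2_ball f e1 g -> H2_ball g e2 h -> H2_ball f (e1 + e2) h.
Proof.
unfold H2_ball. intros H1 H2.
replace (minus h f) with (H2_plus (minus g f) (minus h g)).
- apply Rle_lt_trans with (1 := H2_norm_triangle _ _). lra.
- apply H2_ext; intros z.
  change ((g z + RtoC (-1) * f z + (h z + RtoC (-1) * g z))%C = (h z + RtoC (-1) * f z)%C).
  replace (RtoC (-1)) with (- RtoC 1)%C by (rewrite <- RtoC_opp; reflexivity). ring.
Qed.

Definition H2_UniformSpace_mixin :=
  UniformSpace.Mixin H2_space H2_zero H2_ball H2_ball_center H2_ball_sym H2_ball_triangle.
Canonical H2_UniformSpace := UniformSpace.Pack H2_space H2_UniformSpace_mixin H2_space.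
Canonical H2_NormedModuleAux :=
  NormedModuleAux.Pack C_AbsRing H2_space
    (NormedModuleAux.Class _ _ (ModuleSpace.class _ H2_ModuleSpace) H2_UniformSpace_mixin)
    H2_space.

Lemma H2_norm_compat2 (f g : H2_space) (e : posreal) :
  ball f e g -> H2_norm (minus g f) < 1 * e.
Proof. rewrite Rmult_1_l. exact (fun H => H). Qed.

Definition H2_NormedModule_mixin :=
  NormedModule.Mixin C_AbsRing H2_NormedModuleAux H2_norm 1
    H2_norm_triangle
    (fun k f => Req_le _ _ (H2_norm_scal k f))
    (fun f g e (H : H2_norm (minus g f) < e) => H)
    H2_norm_compat2 H2_norm_eq_0.

Canonical H2 : NormedModule C_AbsRing :=
  NormedModule.Pack C_AbsRing H2_space (NormedModule.Class _ _ _ H2_NormedModule_mixin) H2_space.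

Definition shift (f : H2) : H2 :=
  @mkH2 (fun z => (proj1_sig z * f z)%C) (ex_intro (fun a => has_coef a _) _ (has_coef_shift (H2_coefP f))).

Lemma H2_coef_shift f : H2_coef (shift f) = PS_incr_1 (V := C_NormedModule) (H2_coef f).
Proof. apply H2_coef_unique. exact (has_coef_shift (H2_coefP f)). Qed.

Lemma norm_shift (f : H2) : norm (shift f) = norm f.
Proof.
change (H2_norm (shift f) = H2_norm f). unfold H2_norm. rewrite H2_coef_shift.
apply l2_norm_shift. exact (proj1 (H2_coefP f)).
Qed.

Lemma is_linear_shift : is_linear shift.
Proof.
split.
- intros f g. apply H2_ext; intros z.
  change ((proj1_sig z * (f z + g z))%C = (proj1_sig z * f z + proj1_sig z * g z)%C). ring.
- intros k f. apply H2_ext; intros z.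
  change ((proj1_sig z * (k * f z))%C = (k * (proj1_sig z * f z))%C). ring.
- exists 1. split; [lra|]. intros f. rewrite norm_shift. lra.
Qed.

(* Coefficients of f(z)/(1-wz). *)
Fixpoint resolvent_coef (w : C) (a : nat -> C) (n : nat) : C :=
  match n with
  | O => a O
  | S m => (w * resolvent_coef w a m + a (S m))%C
  end.

Lemma resolvent_coef_square w a : Cmod w < 1 -> square_summable a ->
  square_summable (resolvent_coef w a) /\
  l2_norm (resolvent_coef w a) <= / (1 - Cmod w) * l2_norm a.
Proof.
intros Hw Ha. pose proof (Cmod_ge_0 w) as Hw0. set (r := Cmod w) in *.
set (b := resolvent_coef w a). set (A := Series (fun n => Cmod (a n) ^ 2)).
assert (I0 : 0 < / (1 - r)) by (apply Rinv_0_lt_compat; lra).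
assert (Step : forall n, Cmod (b (S n)) ^ 2 <=
  r * Cmod (b n) ^ 2 + / (1 - r) * Cmod (a (S n)) ^ 2).
{ intros n. change (b (S n)) with (w * b n + a (S n))%C.
  pose proof (Cmod_triangle (w * b n) (a (S n))) as T. rewrite Cmod_mult in T. fold r in T.
  pose proof (Cmod_ge_0 (w * b n + a (S n))).
  pose proof (Cmod_ge_0 (b n)) as Hx. pose proof (Cmod_ge_0 (a (S n))) as Hy.
  set (x := Cmod (b n)) in *. set (y := Cmod (a (S n))) in *.
  apply Rle_trans with ((r * x + y) ^ 2); [apply pow_incr; lra|].
  assert (E : r * x ^ 2 + / (1 - r) * y ^ 2 - (r * x + y) ^ 2
    = r * / (1 - r) * ((1 - r) * x - y) ^ 2) by (field; lra).
  assert (0 <= r * / (1 - r) * ((1 - r) * x - y) ^ 2); [|lra].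
  apply Rmult_le_pos; [apply Rmult_le_pos; lra | apply pow2_ge_0]. }
assert (P : forall n, sum_n (fun k => Cmod (b k) ^ 2) n + r * 0 <=
   r * (sum_n (fun k => Cmod (b k) ^ 2) n) +
   / (1 - r) * sum_n (fun k => Cmod (a k) ^ 2) n - r * Cmod (b n) ^ 2).
{ induction n as [|n IH].
  - rewrite !sum_O. change (b 0%nat) with (a 0%nat).
    pose proof (pow2_ge_0 (Cmod (a 0%nat))).
    assert (1 <= / (1 - r)).
    { rewrite <- Rinv_1. apply Rinv_le_contravar; lra. }
    nra.
  - rewrite !sum_Sn. unfold plus; simpl. specialize (Step n). simpl in Step, IH. nra. }
assert (Q : forall n, sum_n (fun k => Cmod (b k) ^ 2) n <= (/ (1 - r)) ^ 2 * A).
{ intros n. specialize (P n).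
  assert (SA : sum_n (fun k => Cmod (a k) ^ 2) n <= A)
    by exact (@sum_n_le_Series (fun k => Cmod (a k) ^ 2) n (square_nonneg a) Ha).
  pose proof (pow2_ge_0 (Cmod (b n))).
  set (s := sum_n (fun k => Cmod (b k) ^ 2) n) in *.
  assert (K : (1 - r) * s <= / (1 - r) * A) by nra.
  apply (Rmult_le_compat_l (/ (1 - r))) in K; [|lra].
  rewrite <- Rmult_assoc, Rinv_l, Rmult_1_l in K by lra.
  simpl. lra. }
destruct (@ex_series_nonneg (fun n => Cmod (b n) ^ 2) _ (square_nonneg b) Q) as [Hb HS].
split; [exact Hb|]. unfold l2_norm. fold A.
rewrite <- (sqrt_pow2 (/ (1 - r))) by lra.
rewrite <- sqrt_mult_alt by apply pow2_ge_0. apply sqrt_le_1_alt, HS.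
Qed.

Lemma one_minus_neq_0 (w z : C) : Cmod w < 1 -> Cmod z < 1 -> (1 - w * z)%C <> RtoC 0.
Proof.
intros Hw Hz E. assert (E' : (w * z)%C = RtoC 1).
{ replace (w * z)%C with (RtoC 1 - (1 - w * z))%C by ring. rewrite E. ring. }
assert (M : Cmod (w * z) = 1) by (rewrite E'; apply Cmod_1).
rewrite Cmod_mult in M. pose proof (Cmod_ge_0 w). pose proof (Cmod_ge_0 z). nra.
Qed.

Lemma has_coef_resolvent w a f : Cmod w < 1 -> has_coef a f ->
  has_coef (resolvent_coef w a) (fun z => (f z / (1 - w * proj1_sig z))%C).
Proof.
intros Hw [Ha Pa]. destruct (resolvent_coef_square Hw Ha) as [Hb _].
split; [exact Hb|]. intros [z Hz]. specialize (Pa (exist _ z Hz)). simpl in *.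
set (b := resolvent_coef w a) in *. set (fz := f (exist _ z Hz)) in *.
destruct (@ex_pseries_bounded b (l2_norm b) z) as [l Hl]; [|exact Hz|].
{ intros n. apply Cmod_le_l2_norm, Hb. }
pose proof (is_pseries_scal (V := C_NormedModule) (- w : C_AbsRing)%C _ _ _ (Cmult_comm _ _)
  (is_pseries_incr_1 (V := C_NormedModule) _ _ _ Hl)) as H1.
pose proof (is_pseries_plus (V := C_NormedModule) _ _ _ _ _ Hl H1) as H2.
assert (H3 : is_pseries (V := C_NormedModule) a z (l + - w * (z * l))%C).
{ refine (is_pseries_ext (V := C_NormedModule) _ _ _ _ _ H2).
  intros [|n].
  - change ((a 0%nat + - w * RtoC 0)%C = a 0%nat). ring.
  - change ((w * b n + a (S n) + - w * b n)%C = a (S n)). ring. }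
pose proof (is_pseries_value_unique Pa H3) as E.
assert (N := one_minus_neq_0 Hw Hz).
replace (fz / (1 - w * z))%C with l; [exact Hl|].
rewrite E. field. exact N.
Qed.

Definition H2_resolvent (w : C) (Hw : Cmod w < 1) (f : H2) : H2 :=
  @mkH2 (fun z => (f z / (1 - w * proj1_sig z))%C)
    (ex_intro (fun a => has_coef a _) _ (has_coef_resolvent Hw (H2_coefP f))).

Lemma H2_resolventP (w : C) (Hw : Cmod w < 1) :
  is_inverse (fun f : H2 => minus f (scal w (shift f))) (H2_resolvent Hw).
Proof.
assert (V : forall (f : H2) z, (minus f (scal w (shift f)) : H2) z
  = ((1 - w * proj1_sig z) * f z)%C).
{ intros f z.
  change ((f z + RtoC (-1) * (w * (proj1_sig z * f z)))%C
    = ((1 - w * proj1_sig z) * f z)%C).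
  replace (RtoC (-1)) with (- RtoC 1)%C by (rewrite <- RtoC_opp; reflexivity). ring. }
split; [split|split].
- intros f g. apply H2_ext; intros [z Hz]. assert (N := one_minus_neq_0 Hw Hz).
  change (((f (exist _ z Hz) + g (exist _ z Hz)) / (1 - w * z))%C
   = (f (exist _ z Hz) / (1 - w * z) + g (exist _ z Hz) / (1 - w * z))%C).
  field. exact N.
- intros k f. apply H2_ext; intros [z Hz]. assert (N := one_minus_neq_0 Hw Hz).
  change (((k * f (exist _ z Hz)) / (1 - w * z))%C
   = (k * (f (exist _ z Hz) / (1 - w * z)))%C).
  field. exact N.
- exists (/ (1 - Cmod w)). split; [apply Rinv_0_lt_compat; lra|].
  intros f. change (H2_norm (H2_resolvent Hw f) <= / (1 - Cmod w) * H2_norm f).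
  unfold H2_norm.
  rewrite (@H2_coef_unique (H2_resolvent Hw f) _ (has_coef_resolvent Hw (H2_coefP f))).
  apply (resolvent_coef_square Hw (proj1 (H2_coefP f))).
- intros f. apply H2_ext; intros z. pose proof (one_minus_neq_0 Hw (proj2_sig z)) as N.
  change (((minus f (scal w (shift f)) : H2) z / (1 - w * proj1_sig z))%C = f z).
  rewrite V. field. exact N.
- intros f. apply H2_ext; intros z. pose proof (one_minus_neq_0 Hw (proj2_sig z)) as N.
  rewrite V. change (((1 - w * proj1_sig z) * (f z / (1 - w * proj1_sig z)))%C = f z).
  field. exact N.
Qed.

Lemma shift_disc_resolvent (w : C) : Cmod w < 1 ->
  is_inverse (fun f : H2 => minus f (scal (Cconj w) (shift f))) (disc_resolvent shift w).
Proof.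
intros Hw. assert (Hw' : Cmod (Cconj w) < 1) by (rewrite Cmod_conj; exact Hw).
unfold disc_resolvent. rewrite (op_inv_correct (H2_resolventP Hw')).
exact (H2_resolventP Hw').
Qed.

(* The standing assumption on A in the notion of admissibility holds for A = S. *)
Lemma shift_spectrum (lambda : C) : in_spectrum shift lambda -> Cmod lambda <= 1.
Proof.
intros H. destruct (Rle_lt_dec (Cmod lambda) 1) as [L|L]; [exact L|].
exfalso. apply H.
assert (N : lambda <> RtoC 0) by (apply Cmod_gt_0; lra).
assert (Hw : Cmod (/ lambda) < 1).
{ rewrite Cmod_inv by exact N. rewrite <- Rinv_1. apply Rinv_lt_contravar; lra. }
destruct (H2_resolventP Hw) as [[P1 P2 [M [M0 P3]]] [I1 I2]].
assert (E : forall f : H2, minus (scal lambda f) (shift f)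
   = scal lambda (minus f (scal (/ lambda)%C (shift f)))).
{ intros f. apply H2_ext; intros z.
  change ((lambda * f z + RtoC (-1) * (proj1_sig z * f z))%C
   = (lambda * (f z + RtoC (-1) * (/ lambda * (proj1_sig z * f z))))%C).
  field. exact N. }
assert (K1 : forall f : H2, scal (/ lambda)%C (scal lambda f) = f).
{ intros f. apply H2_ext; intros z.
  change ((/ lambda * (lambda * f z))%C = f z). field. exact N. }
assert (K2 : forall f : H2, scal lambda (scal (/ lambda)%C f) = f).
{ intros f. apply H2_ext; intros z.
  change ((lambda * (/ lambda * f z))%C = f z). field. exact N. }
exists (fun f => H2_resolvent Hw (scal (/ lambda)%C f)). split; [split|split].
- intros f g. refine (eq_trans (f_equal (H2_resolvent Hw) _) (P1 _ _)).
  exact (H2_scal_distr_l _ _ _).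
- intros k f. refine (eq_trans (f_equal (H2_resolvent Hw) _) (P2 _ _)).
  apply H2_ext; intros z.
  change ((/ lambda * (k * f z))%C = (k * (/ lambda * f z))%C). ring.
- exists M. split; [exact M0|]. intros f. apply Rle_trans with (1 := P3 _).
  change (M * H2_norm (H2_scal (/ lambda)%C f) <= M * H2_norm f).
  rewrite H2_norm_scal.
  assert (0 <= H2_norm f) by apply sqrt_pos. pose proof (Cmod_ge_0 (/ lambda)).
  apply Rmult_le_compat_l; [lra|]. nra.
- intros f. rewrite E, K1. apply I1.
- intros f. rewrite E, I2. apply K2.
Qed.

(* Main.v *)
Require Import Defs.
From Stdlib Require Import Reals Lra Lia.
From Coquelicot Require Import Coquelicot.
Open Scope R_scope.

(* Write c_m = C(z^m), so that C S^n x = sum_k c_{n+k} x_k is a Hankel form.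

   (i) Put s_j = exp(-2^-j), so that s_{j+1}^2 = s_j. The telescoping identity
   1 = s_0^{4m} + sum_j (s_j^{2m} - s_j^{4m}) splits c_m into dyadic pieces
   s_j^m * c_m (s_j^m - s_j^{3m}). The factor s_j^m = s_j^n s_j^k, for m = n + k,
   absorbs the weight (1+n)^{beta/2} at the price 2^{j beta/2}, and the Hankel
   matrix of the rest is bounded by the supremum on |z| = 1 of its symbol
   sum_m c_m (s_j^m - s_j^{3m}) z^m. With w = s_j z and v = s_j^3 z that symbol
   is C(P), where P = (I - wS)^{-1} (w - v) S (I - vS)^{-1} 1, so the resolvent
   condition bounds it by a multiple of 2^{-j alpha/2}. Summing the geometric
   series of ratio 2^{-(alpha-beta)/2} gives (i).

   (ii) The functional f |-> sum_j 2^{-j alpha/2} f_{2^j} satisfies the resolvent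
   condition by the triangle inequality, since the 2^j-th coefficient of
   (I - wS)^{-1} f is at most min(2^j + 1, 1/(1-|w|^2))^{1/2} |f|; but for x = 1
   the terms of index 2^j in the admissibility series are at least 1. *)

(** * Finite sums and roots of unity *)

(** The finite sum with terms fixed in C, so that the rules below are stated with the complex
    operations. Both ends 0 and n are included. *)
Definition Csum (a : nat -> C) (n : nat) : C := sum_n a n.

Lemma Csum_O (a : nat -> C) : Csum a 0 = a 0%nat.
Proof. exact (sum_O a). Qed.

Lemma Csum_S (a : nat -> C) n : Csum a (S n) = (Csum a n + a (S n))%C.
Proof. exact (sum_Sn a n). Qed.

Lemma Csum_ext (a b : nat -> C) n :
  (forall k, (k <= n)%nat -> a k = b k) -> Csum a n = Csum b n.
Proof. exact (sum_n_ext_loc a b n). Qed.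

Lemma Csum_plus (a b : nat -> C) n :
  Csum (fun k => (a k + b k)%C) n = (Csum a n + Csum b n)%C.
Proof. exact (sum_n_plus a b n). Qed.

Lemma Csum_mult_l (x : C) (a : nat -> C) n :
  Csum (fun k => (x * a k)%C) n = (x * Csum a n)%C.
Proof. exact (sum_n_mult_l (K := C_Ring) x a n). Qed.

Lemma Csum_mult_r (x : C) (a : nat -> C) n :
  Csum (fun k => (a k * x)%C) n = (Csum a n * x)%C.
Proof. exact (sum_n_mult_r (K := C_Ring) x a n). Qed.

Lemma Csum_switch (u : nat -> nat -> C) m n :
  Csum (fun i => Csum (u i) n) m = Csum (fun j => Csum (fun i => u i j) m) n.
Proof. exact (sum_n_switch u m n). Qed.

Lemma Cconj_Csum (a : nat -> C) n : Cconj (Csum a n) = Csum (fun k => Cconj (a k)) n.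
Proof.
induction n as [|n IH]; [now rewrite !Csum_O|].
now rewrite !Csum_S, Cplus_conj, IH.
Qed.

Lemma RtoC_sum_n (a : nat -> R) n : RtoC (sum_n a n) = Csum (fun k => RtoC (a k)) n.
Proof.
induction n as [|n IH]; [now rewrite Csum_O, sum_O|].
rewrite Csum_S, sum_Sn, <- IH. apply RtoC_plus.
Qed.

Lemma Csum_delta (x : nat -> C) m n :
  Csum (fun k => if (k =? m)%nat then x k else RtoC 0) n
  = if (m <=? n)%nat then x m else RtoC 0.
Proof.
induction n as [|n IH].
- rewrite Csum_O. now destruct m.
- rewrite Csum_S, IH.
  destruct (Nat.eqb_spec (S n) m), (Nat.leb_spec m n), (Nat.leb_spec m (S n));
    try lia; subst; ring.
Qed.

Lemma sum_n_le (a b : nat -> R) n :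
  (forall k, (k <= n)%nat -> a k <= b k) -> sum_n a n <= sum_n b n.
Proof.
induction n as [|n IH]; intros H; [rewrite !sum_O; auto|].
rewrite !sum_Sn. apply Rplus_le_compat; [apply IH; intros; apply H; lia|apply H; lia].
Qed.

Lemma sum_n_scal_R (x : R) (a : nat -> R) n :
  sum_n (fun k => x * a k) n = x * sum_n a n.
Proof. exact (sum_n_mult_l (K := R_Ring) x a n). Qed.

Lemma sum_n_nonneg (a : nat -> R) n : (forall k, 0 <= a k) -> 0 <= sum_n a n.
Proof.
intros H; induction n as [|n IH]; [rewrite sum_O; auto|].
rewrite sum_Sn. apply Rplus_le_le_0_compat; auto.
Qed.

Lemma Cmod_Csum_le (a : nat -> C) n : Cmod (Csum a n) <= sum_n (fun k => Cmod (a k)) n.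
Proof.
induction n as [|n IH]; [rewrite Csum_O, sum_O; lra|].
rewrite Csum_S, sum_Sn. apply Rle_trans with (1 := Cmod_triangle _ _).
apply Rplus_le_compat_r, IH.
Qed.

Definition cis (t : R) : C := (cos t, sin t).

Lemma cis_plus s t : cis (s + t) = (cis s * cis t)%C.
Proof.
unfold cis, Cmult; simpl. rewrite cos_plus, sin_plus. f_equal; ring.
Qed.

Lemma cis_pow t n : (cis t ^ n)%C = cis (INR n * t).
Proof.
induction n as [|n IH].
- simpl. rewrite Rmult_0_l. unfold cis. now rewrite cos_0, sin_0.
- rewrite Cpow_S, IH, <- cis_plus. f_equal. rewrite S_INR. ring.
Qed.

Lemma Cconj_cis t : Cconj (cis t) = cis (- t).
Proof. unfold cis, Cconj; simpl. now rewrite cos_neg, sin_neg. Qed.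

Lemma Cmod_cis t : Cmod (cis t) = 1.
Proof.
unfold Cmod, cis; simpl. rewrite !Rmult_1_r, Rplus_comm.
change (sqrt (Rsqr (sin t) + Rsqr (cos t)) = 1). rewrite sin2_cos2. apply sqrt_1.
Qed.

(** The half-angle formula gives cos t = 1 - 2 sin(|t|/2)^2, and the sine is positive because |t|/2
    lies strictly between 0 and pi. *)
Lemma cis_neq_1 t : 0 < Rabs t < 2 * PI -> cis t <> RtoC 1.
Proof.
intros Ht E. injection E as E _.
assert (Hc : cos t = 1 - 2 * (sin (Rabs t / 2) * sin (Rabs t / 2))).
{ replace (cos t) with (cos (2 * (Rabs t / 2))).
  - rewrite cos_2a_sin. ring.
  - replace (2 * (Rabs t / 2)) with (Rabs t) by field.
    unfold Rabs. destruct (Rcase_abs t); [apply cos_neg|reflexivity]. }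
assert (0 < sin (Rabs t / 2)) by (apply sin_gt_0; lra).
nra.
Qed.

Lemma Csum_geom (u : C) n : ((u - 1) * Csum (fun l => u ^ l) n)%C = (u ^ S n - 1)%C.
Proof.
induction n as [|n IH]; [rewrite Csum_O; simpl; ring|].
rewrite Csum_S, Cmult_plus_distr_l, IH, !Cpow_S. ring.
Qed.

(** There are D + 1 roots, indexed by l = 0, ..., D, so that a sum over all of them is
    [Csum _ D]. *)
Definition root_of_unity (D l : nat) : C := cis (INR l * (2 * PI / INR (S D))).

(** The terms are the powers of e^{it} with t = 2 pi (a - b) / (D + 1). For a <> b the bound |a - b|
    <= D keeps this ratio away from 1, while its power D + 1 equals 1, so the geometric sum
    vanishes. *)
Lemma root_of_unity_orthogonal D a b : (a <= D)%nat -> (b <= D)%nat ->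
  Csum (fun l => (root_of_unity D l ^ a * Cconj (root_of_unity D l) ^ b)%C) D
  = if (a =? b)%nat then RtoC (INR (S D)) else RtoC 0.
Proof.
intros Ha Hb. pose proof (lt_0_INR (S D) ltac:(lia)) as HD.
set (t := (INR a - INR b) * (2 * PI / INR (S D))).
rewrite (Csum_ext _ (fun l => (cis t ^ l)%C)).
2:{ intros l _. unfold root_of_unity.
    rewrite Cconj_cis, !cis_pow, <- cis_plus. f_equal. unfold t. ring. }
destruct (Nat.eqb_spec a b) as [->|N].
- assert (E : cis t = RtoC 1).
  { unfold t. rewrite Rminus_diag, Rmult_0_l. unfold cis. now rewrite cos_0, sin_0. }
  rewrite (Csum_ext _ (fun _ => RtoC 1)) by (intros l _; rewrite E; apply Cpow_1_l).
  rewrite <- RtoC_sum_n, sum_n_const, Rmult_1_r. reflexivity.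
- assert (E : (cis t ^ S D)%C = RtoC 1).
  { rewrite cis_pow.
    replace (INR (S D) * t) with ((INR a) * (2 * PI) + - (INR b * (2 * PI))) by (unfold t; field; lra).
    assert (P : forall k, cis (INR k * (2 * PI)) = RtoC 1).
    { intros k. rewrite <- cis_pow.
      replace (cis (2 * PI)) with (RtoC 1) by (unfold cis; now rewrite cos_2PI, sin_2PI).
      apply Cpow_1_l. }
    rewrite cis_plus, <- Cconj_cis, !P. apply injective_projections; simpl; ring. }
  assert (Z := Csum_geom (cis t) D). rewrite E in Z.
  assert (NZ : cis t <> RtoC 1).
  { apply cis_neq_1. unfold t. rewrite Rabs_mult.
    assert (P := PI_RGT_0).
    assert (Q : 0 < 2 * PI / INR (S D)) by (apply Rdiv_lt_0_compat; lra).
    rewrite (Rabs_right (2 * PI / _)) by lra.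
    assert (A : 0 < Rabs (INR a - INR b) < INR (S D)).
    { split; [apply Rabs_pos_lt; intros K; apply N, INR_eq; lra|].
      apply le_INR in Ha, Hb. rewrite S_INR.
      pose proof (pos_INR a). pose proof (pos_INR b). apply Rabs_def1; lra. }
    split; [apply Rmult_lt_0_compat; lra|].
    apply Rlt_le_trans with (INR (S D) * (2 * PI / INR (S D)));
      [apply Rmult_lt_compat_r; lra|right; field; lra]. }
  assert (NZ' : (cis t - 1)%C <> RtoC 0).
  { intros K. apply NZ. replace (cis t) with (cis t - 1 + 1)%C by ring. rewrite K. ring. }
  match goal with |- ?s = _ =>
    replace s with (/ (cis t - 1) * ((cis t - 1) * s))%C by (field; exact NZ') end.
  rewrite Z. replace (1 - 1)%C with (RtoC 0) by ring. ring.
Qed.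

(** A discrete substitute for integration over the unit circle: after expansion, orthogonality keeps
    only m = n + k. The bound M <= D prevents aliasing of exponents modulo D + 1, and n + K <= M
    makes every m = n + k occur. *)
Lemma roots_of_unity_pairing (X b : nat -> C) n K M D :
  (n + K <= M)%nat -> (M <= D)%nat ->
  Csum (fun l => let z := root_of_unity D l in
    (z ^ n * Csum (fun k => X k * z ^ k) K * Csum (fun m => b m * Cconj z ^ m) M)%C) D
  = (RtoC (INR (S D)) * Csum (fun k => X k * b (n + k)%nat) K)%C.
Proof.
intros HM HD. cbv zeta.
rewrite (Csum_ext _ (fun l => Csum (fun k => Csum (fun m =>
  (X k * b m * (root_of_unity D l ^ (n + k) * Cconj (root_of_unity D l) ^ m))%C) M) K)).
2:{ intros l _. set (z := root_of_unity D l).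
    rewrite <- (Csum_mult_l (z ^ n)%C), <- Csum_mult_r. apply Csum_ext. intros k _.
    rewrite <- Csum_mult_l. apply Csum_ext. intros m _. rewrite Cpow_add_r. ring. }
rewrite Csum_switch, <- Csum_mult_l. apply Csum_ext. intros k Hk.
rewrite Csum_switch.
rewrite (Csum_ext _ (fun m => if (m =? n + k)%nat
   then (X k * b m * RtoC (INR (S D)))%C else RtoC 0)).
2:{ intros m Hm. rewrite Csum_mult_l, root_of_unity_orthogonal by lia.
    rewrite Nat.eqb_sym. destruct (m =? n + k)%nat; ring. }
rewrite Csum_delta. destruct (Nat.leb_spec (n + k) M); [ring|lia].
Qed.

(** The case n = 0 of the pairing, with b the conjugate of X. *)
Lemma roots_of_unity_parseval (X : nat -> C) K D : (K <= D)%nat ->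
  sum_n (fun l => Cmod (Csum (fun k => (X k * root_of_unity D l ^ k)%C) K) ^ 2) D
  = INR (S D) * sum_n (fun k => Cmod (X k) ^ 2) K.
Proof.
intros HK. apply RtoC_inj.
rewrite RtoC_mult, !RtoC_sum_n.
rewrite (Csum_ext _ _ K (fun k _ => Cmod2_conj (X k))).
refine (eq_trans _
  (roots_of_unity_pairing X (fun k => Cconj (X k)) 0 K K D (le_n K) HK)).
apply Csum_ext. intros l _. cbv zeta. rewrite Cmod2_conj, Cconj_Csum. simpl Cpow at 2.
rewrite Cmult_1_l. f_equal. apply Csum_ext. intros k _. now rewrite Cmult_conj, Cpow_conj.
Qed.

(** The easy half of Nehari's theorem in finite form: (D + 1) times the form is the sum over the
    roots of unity of PY PX Pb, where |Pb| <= B and |PX| |PY| <= (|PX|^2 + |PY|^2) / 2; Parseval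
    then evaluates the squares. The half sum of squares replaces the product of norms; a scaling of
    one variable recovers the sharp bound in [admissible_poly]. *)
Lemma hankel_form_le (b X Y : nat -> C) N K D (B : R) : (N + K <= D)%nat ->
  (forall z, Cmod z = 1 -> Cmod (Csum (fun m => (b m * z ^ m)%C) D) <= B) ->
  Cmod (Csum (fun n => (Y n * Csum (fun k => X k * b (n + k)%nat) K)%C) N)
  <= B / 2 * (sum_n (fun k => Cmod (X k) ^ 2) K + sum_n (fun n => Cmod (Y n) ^ 2) N).
Proof.
intros HD HB. pose proof (lt_0_INR (S D) ltac:(lia)) as HL.
set (PX := fun l => Csum (fun k => (X k * root_of_unity D l ^ k)%C) K).
set (PY := fun l => Csum (fun n => (Y n * root_of_unity D l ^ n)%C) N).
set (Pb := fun l => Csum (fun m => (b m * Cconj (root_of_unity D l) ^ m)%C) D).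
set (T := Csum _ N).
assert (E : (RtoC (INR (S D)) * T)%C = Csum (fun l => (PY l * PX l * Pb l)%C) D).
{ unfold T. rewrite <- Csum_mult_l.
  rewrite (Csum_ext _ (fun n => Csum (fun l =>
    (Y n * root_of_unity D l ^ n * PX l * Pb l)%C) D)).
  2:{ intros n Hn.
      pose proof (roots_of_unity_pairing X b n K D D ltac:(lia) ltac:(lia)) as P.
      cbv zeta in P.
      rewrite Cmult_assoc, (Cmult_comm _ (Y n)), <- Cmult_assoc, <- P, <- Csum_mult_l.
      apply Csum_ext. intros l _. unfold PX, Pb. ring. }
  rewrite Csum_switch. apply Csum_ext. intros l _.
  rewrite !Csum_mult_r. reflexivity. }
apply (f_equal Cmod) in E. rewrite Cmod_mult, Cmod_R, Rabs_right in E by lra.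
apply (Rmult_le_reg_l (INR (S D))); [exact HL|]. rewrite E.
apply Rle_trans with (1 := Cmod_Csum_le _ _).
apply Rle_trans with (sum_n (fun l => B / 2 * (Cmod (PX l) ^ 2 + Cmod (PY l) ^ 2)) D).
- apply sum_n_le. intros l _. rewrite !Cmod_mult.
  assert (Hb : Cmod (Pb l) <= B).
  { apply HB. rewrite Cmod_conj. apply Cmod_cis. }
  pose proof (Cmod_ge_0 (Pb l)). pose proof (Cmod_ge_0 (PX l)). pose proof (Cmod_ge_0 (PY l)).
  pose proof (pow2_ge_0 (Cmod (PX l) - Cmod (PY l))).
  apply Rle_trans with (Cmod (PY l) * Cmod (PX l) * B); [|nra].
  apply Rmult_le_compat_l; [apply Rmult_le_pos|]; assumption.
- rewrite sum_n_scal_R.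
  rewrite (sum_n_plus (G := R_AbelianMonoid) (fun l => Cmod (PX l) ^ 2) (fun l => Cmod (PY l) ^ 2)).
  unfold PX, PY. rewrite !roots_of_unity_parseval by lia.
  right. unfold plus; simpl. ring.
Qed.

(** * Polynomials in H^2 *)

Lemma sum_n_finite_support (a : nat -> R) K n :
  (forall k, (K < k)%nat -> a k = 0) -> (K <= n)%nat -> sum_n a n = sum_n a K.
Proof.
intros H. induction 1 as [|n Hn IH]; [reflexivity|].
rewrite sum_Sn, IH, (H (S n)) by lia. apply Rplus_0_r.
Qed.

Lemma is_series_finite_support (a : nat -> R) K :
  (forall k, (K < k)%nat -> a k = 0) -> is_series a (sum_n a K).
Proof.
intros H. apply (filterlim_ext_loc (fun _ => sum_n a K)); [|apply filterlim_const].
exists K. intros n Hn. symmetry. now apply sum_n_finite_support.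
Qed.

Definition delta0 (n : nat) : C := match n with O => RtoC 1 | S _ => RtoC 0 end.

Lemma has_coef_one : has_coef delta0 (fun _ => RtoC 1).
Proof.
split.
- eexists. apply (is_series_finite_support _ 0). intros [|k] Hk; [lia|].
  simpl. rewrite Cmod_0. ring.
- intros z. unfold is_pseries.
  apply (filterlim_ext (fun _ => RtoC 1)); [|apply filterlim_const].
  intros n. induction n as [|n IH].
  + rewrite sum_O. symmetry. exact (Cmult_1_l _).
  + rewrite sum_Sn, <- IH.
    change (RtoC 1 = (1 + pow_n (K := C_Ring) (proj1_sig z) (S n) * 0)%C). ring.
Qed.

Definition H2_one : H2 :=
  @mkH2 (fun _ => RtoC 1) (ex_intro (fun a => has_coef a _) _ has_coef_one).

(** Taken as S^n 1 rather than by its values, so that S^n z^k = z^{n+k} is additivity of iteration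
    and the norm follows from S being isometric. *)
Definition monomial (n : nat) : H2 := Nat.iter n shift H2_one.

Lemma monomial_value n (z : Defs.disc) : (monomial n : H2) z = (proj1_sig z ^ n)%C.
Proof.
induction n as [|n IH]; [reflexivity|].
change ((proj1_sig z * (monomial n : H2) z)%C = (proj1_sig z ^ S n)%C).
now rewrite IH.
Qed.

Lemma H2_coef_monomial n k :
  H2_coef (monomial n) k = if (k =? n)%nat then RtoC 1 else RtoC 0.
Proof.
revert k. induction n as [|n IH]; intros k.
- rewrite (H2_coef_unique (f := monomial 0) has_coef_one). now destruct k.
- change (monomial (S n)) with (shift (monomial n)). rewrite H2_coef_shift.
  destruct k as [|k]; [reflexivity|]. exact (IH k).
Qed.

Lemma is_linear_iter_shift n : is_linear (Nat.iter n shift).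
Proof.
induction n as [|n IH]; [exact is_linear_id|].
exact (is_linear_comp _ _ IH is_linear_shift).
Qed.

Lemma norm_iter_shift n (f : H2) : norm (Nat.iter n shift f) = norm f.
Proof.
induction n as [|n IH]; [reflexivity|].
change (Nat.iter (S n) shift f) with (shift (Nat.iter n shift f)).
now rewrite norm_shift.
Qed.

Lemma iter_shift_monomial n k : Nat.iter n shift (monomial k) = monomial (n + k).
Proof. unfold monomial. now rewrite Nat.iter_add. Qed.

Lemma norm_H2_sqr (f : H2) : norm f ^ 2 = Series (fun n => Cmod (H2_coef f n) ^ 2).
Proof. exact (l2_norm_sqr (proj1 (H2_coefP f))). Qed.

Definition H2_poly (x : nat -> C) (K : nat) : H2 :=
  sum_n (fun k => scal (x k) (monomial k)) K.

Lemma H2_poly_O x : H2_poly x 0 = scal (x 0%nat) (monomial 0).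
Proof. exact (sum_O _). Qed.

Lemma H2_poly_S x K : H2_poly x (S K) = plus (H2_poly x K) (scal (x (S K)) (monomial (S K))).
Proof. exact (sum_Sn _ _). Qed.

Lemma linear_H2_poly (c : H2 -> C) x K : is_linear c ->
  c (H2_poly x K) = Csum (fun k => (x k * c (monomial k))%C) K.
Proof.
intros Hc. induction K as [|K IH].
- rewrite H2_poly_O, Csum_O. exact (linear_scal c Hc _ _).
- rewrite H2_poly_S, Csum_S, <- IH. rewrite (linear_plus c Hc).
  exact (f_equal (Cplus _) (linear_scal c Hc _ _)).
Qed.

Lemma H2_coef_poly x K n :
  H2_coef (H2_poly x K) n = if (n <=? K)%nat then x n else RtoC 0.
Proof.
induction K as [|K IH].
- rewrite H2_poly_O.
  change (H2_coef (H2_scal (x 0%nat) (monomial 0)) n = if (n <=? 0)%nat then x n else RtoC 0).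
  rewrite H2_coef_scal, H2_coef_monomial. destruct n; simpl; ring.
- rewrite H2_poly_S.
  change (H2_coef (H2_plus (H2_poly x K) (H2_scal (x (S K)) (monomial (S K)))) n
    = if (n <=? S K)%nat then x n else RtoC 0).
  rewrite H2_coef_plus, H2_coef_scal, H2_coef_monomial, IH.
  destruct (Nat.eqb_spec n (S K)), (Nat.leb_spec n K), (Nat.leb_spec n (S K));
    try lia; subst; ring.
Qed.

Lemma norm_H2_poly_sqr x K : norm (H2_poly x K) ^ 2 = sum_n (fun k => Cmod (x k) ^ 2) K.
Proof.
rewrite norm_H2_sqr.
rewrite (is_series_unique _ (sum_n (fun k => Cmod (H2_coef (H2_poly x K) k) ^ 2) K)).
- apply sum_n_ext_loc. intros k Hk. rewrite H2_coef_poly.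
  destruct (Nat.leb_spec k K); [reflexivity|lia].
- apply is_series_finite_support. intros k Hk. rewrite H2_coef_poly.
  destruct (Nat.leb_spec k K); [lia|]. rewrite Cmod_0. ring.
Qed.

Lemma norm_monomial n : norm (monomial n) = 1.
Proof.
unfold monomial. rewrite norm_iter_shift.
assert (E : norm H2_one ^ 2 = 1).
{ rewrite norm_H2_sqr. apply is_series_unique.
  replace 1 with (sum_n (fun n => Cmod (H2_coef H2_one n) ^ 2) 0).
  - apply is_series_finite_support. intros k Hk.
    change H2_one with (monomial 0). rewrite H2_coef_monomial.
    destruct k; [lia|]. simpl. rewrite Cmod_0. ring.
  - rewrite sum_O. change H2_one with (monomial 0). rewrite H2_coef_monomial. simpl.
    rewrite Cmod_1. ring. }
pose proof (norm_ge_0 H2_one). nra.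
Qed.

Lemma H2_coef_minus (f g : H2) n :
  H2_coef (minus f g) n = (H2_coef f n - H2_coef g n)%C.
Proof.
change (H2_coef (H2_plus f (H2_scal (RtoC (-1)) g)) n = (H2_coef f n - H2_coef g n)%C).
rewrite H2_coef_plus, H2_coef_scal.
replace (RtoC (-1)) with (- RtoC 1)%C by (rewrite <- RtoC_opp; reflexivity). ring.
Qed.

(** The error is the square root of the tail of the convergent series of squared coefficients. *)
Lemma H2_poly_coef_lim (f : H2) :
  is_lim_seq (fun K => norm (minus f (H2_poly (H2_coef f) K))) 0.
Proof.
set (a := fun n => Cmod (H2_coef f n) ^ 2).
assert (Ha : ex_series a) by exact (proj1 (H2_coefP f)).
assert (E : forall K, norm (minus f (H2_poly (H2_coef f) K)) = sqrt (Series a - sum_n a K)).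
{ intros K. rewrite <- (sqrt_pow2 (norm _)) by apply norm_ge_0. f_equal.
  rewrite norm_H2_sqr.
  (* The squared coefficients cut off after K: the squared norm of the error becomes a difference of
     two convergent series. *)
  pose (t := fun n => if (n <=? K)%nat then a n else 0).
  assert (Ht : is_series t (sum_n a K)).
  { rewrite (sum_n_ext_loc a t).
    - apply is_series_finite_support. intros k Hk. unfold t.
      destruct (Nat.leb_spec k K); [lia|reflexivity].
    - intros k Hk. unfold t. destruct (Nat.leb_spec k K); [reflexivity|lia]. }
  rewrite <- (is_series_unique _ _ Ht), <- Series_minus; [|exact Ha|eexists; exact Ht].
  apply Series_ext. intros n. rewrite H2_coef_minus, H2_coef_poly. unfold t, a.
  destruct (n <=? K)%nat.
  - replace (H2_coef f n - H2_coef f n)%C with (RtoC 0) by ring. rewrite Cmod_0. ring.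
  - replace (H2_coef f n - 0)%C with (H2_coef f n) by ring. ring. }
apply (is_lim_seq_ext (fun K => sqrt (Series a - sum_n a K))); [intros; symmetry; apply E|].
rewrite <- sqrt_0. apply (is_lim_seq_continuous sqrt).
- apply continuity_pt_sqrt. lra.
- replace (Finite 0) with (Finite (Series a - Series a)) by (f_equal; ring).
  apply is_lim_seq_minus'; [apply is_lim_seq_const|exact (Series_correct _ Ha)].
Qed.

(** * The resolvent condition as an a priori estimate *)

(** With g = f - wSf one has f = (I - wS)^{-1} g, so the condition becomes an inequality for
    arbitrary f in which no inverse operator appears. It is later tested on explicit polynomials. *)
Lemma resolvent_condition_bound alpha (c : H2 -> C) :
  is_linear c -> resolvent_condition alpha shift c ->
  exists M, 0 < M /\ forall (w : C) (f : H2), Cmod w < 1 ->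
    Cmod (c f) <= M * Rpower (1 - Cmod w ^ 2) (- ((1 - alpha) / 2))
      * norm (minus f (scal w (shift f))).
Proof.
intros Hc Hr. unfold resolvent_condition in Hr.
match type of Hr with Rbar_lt (Lub_Rbar ?E) _ => set (S := E) in * end.
destruct (Lub_Rbar_correct S) as [Hub _].
assert (HM : exists M, 0 < M /\ forall r, S r -> r <= M).
{ destruct (Lub_Rbar S) as [m| |]; [|contradiction|].
  - exists (Rabs m + 1). pose proof (Rabs_pos m). pose proof (Rle_abs m).
    split; [lra|]. intros r Hs. pose proof (Hub r Hs) as K. simpl in K. lra.
  - exists 1. split; [lra|]. intros r Hs. contradiction (Hub r Hs). }
destruct HM as [M [M0 HM]]. exists M. split; [exact M0|]. intros w f Hw.
(* [disc_resolvent] conjugates its parameter, so the condition is used at the conjugate of w. *)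
assert (Hw' : Cmod (Cconj w) < 1) by now rewrite Cmod_conj.
destruct (shift_disc_resolvent Hw') as [RL [R1 _]].
rewrite Cconj_conj in R1.
set (g := minus f (scal w (shift f))).
assert (Hf : f = disc_resolvent shift (Cconj w) g) by (symmetry; apply R1).
assert (LD : is_linear (fun x => c (disc_resolvent shift (Cconj w) x)))
  by exact (is_linear_comp _ _ RL Hc).
pose proof (HM _ (ex_intro _ (Cconj w) (conj Hw' eq_refl))) as Q.
rewrite Cmod_conj in Q.
destruct (dual_norm_is_lub LD) as [U _].
set (dn := dual_norm _) in *.
rewrite Rpower_Ropp. set (p := Rpower _ _) in *.
assert (p0 : 0 < p) by apply exp_pos.
assert (D : dn <= M * / p).
{ apply (Rmult_le_reg_l p); [exact p0|]. rewrite (Rmult_comm M), <- Rmult_assoc, Rinv_r by lra.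
  lra. }
apply Rle_trans with (dn * norm g);
  [|apply Rmult_le_compat_r; [apply norm_ge_0|exact D]].
(* The dual norm only speaks of the unit ball: g = 0 gives c f = 0 by linearity, and otherwise g is
   normalised. *)
destruct (Req_dec (norm g) 0) as [G0|G0].
- rewrite G0, Hf, (norm_eq_zero _ G0), (Defs.linear_zero LD), Cmod_0. lra.
- pose proof (norm_ge_0 g) as G1.
  pose (u := scal (RtoC (/ norm g)) g : H2).
  assert (Cn : Cmod (RtoC (/ norm g)) = / norm g).
  { rewrite Cmod_R, Rabs_right; [reflexivity|].
    left. apply Rinv_0_lt_compat. lra. }
  assert (Nu : norm u <= 1).
  { unfold u. change (H2_norm (H2_scal (RtoC (/ norm g)) g) <= 1).
    rewrite H2_norm_scal, Cn. change (/ norm g * norm g <= 1). rewrite Rinv_l; lra. }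
  pose proof (U _ (ex_intro _ u (conj Nu eq_refl))) as V. simpl in V.
  unfold u in V.
  replace (c (disc_resolvent shift (Cconj w) (scal (RtoC (/ norm g)) g)))
    with (RtoC (/ norm g) * c f)%C in V.
  + rewrite Cmod_mult, Cn in V.
    apply (Rmult_le_compat_r (norm g)) in V; [|lra].
    replace (/ norm g * Cmod (c f) * norm g) with (Cmod (c f)) in V by (field; lra).
    exact V.
  + rewrite Hf at 1. symmetry. exact (linear_scal _ LD _ _).
Qed.

(** * Symbols on dyadic circles *)

Lemma H2_poly_value x K (z : Defs.disc) :
  (H2_poly x K : H2) z = Csum (fun k => (x k * proj1_sig z ^ k)%C) K.
Proof.
induction K as [|K IH].
- rewrite H2_poly_O, Csum_O, <- monomial_value. reflexivity.
- rewrite H2_poly_S, Csum_S, <- IH, <- monomial_value. reflexivity.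
Qed.

(** P truncates 1/(1 - wz) - 1/(1 - vz) = (w - v) z / ((1 - wz)(1 - vz)) to degree D + 1.
    Multiplication by 1 - wz leaves (w - v) z times a truncated geometric series in vz, up to a
    boundary term of degree D + 2. *)
Lemma resolvent_difference_poly (w v : C) D :
  let P := H2_poly (fun m => (w ^ m - v ^ m)%C) (S D) in
  minus P (scal w (shift P))
  = minus (scal (w - v)%C (shift (H2_poly (fun m => (v ^ m)%C) D)))
      (scal (w ^ S (S D) - w * v ^ S D)%C (monomial (S (S D)))).
Proof.
intros P. apply H2_ext. intros z.
set (G := H2_poly _ D).
change ((P z + RtoC (-1) * (w * (proj1_sig z * P z)))%C
  = ((w - v) * (proj1_sig z * G z) + RtoC (-1) *
      ((w ^ S (S D) - w * v ^ S D) * (monomial (S (S D)) : H2) z))%C).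
rewrite monomial_value. unfold P, G. rewrite !H2_poly_value.
set (y := proj1_sig z).
replace (RtoC (-1)) with (- RtoC 1)%C by (rewrite <- RtoC_opp; reflexivity).
clear P G. induction D as [|D IH].
- rewrite Csum_S, !Csum_O. simpl. ring.
- rewrite Csum_S, (Csum_S (fun m => v ^ m * y ^ m)%C D).
  set (p := Csum _ (S D)) in *. set (g := Csum _ D) in *.
  rewrite !Cpow_S in *.
  match type of IH with ?l = ?r =>
    transitivity (l + (w * (w * w ^ D) - v * (v * v ^ D)) * (y * (y * y ^ D))
      - w * (y * ((w * (w * w ^ D) - v * (v * v ^ D)) * (y * (y * y ^ D)))))%C;
    [ring|rewrite IH; ring] end.
Qed.

Lemma geom_sum_n_le (x : R) n : 0 <= x < 1 -> sum_n (fun k => x ^ k) n <= / (1 - x).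
Proof.
intros Hx.
rewrite <- (Series_geom x) by (rewrite Rabs_right; lra).
apply sum_n_le_Series; [intros k; apply pow_le; lra|].
apply ex_series_geom. rewrite Rabs_right; lra.
Qed.

(** The full series is a Szego kernel, of squared norm 1 / (1 - |v|^2); truncation only lowers the
    norm. *)
Lemma norm_geom_poly_le (v : C) D : Cmod v < 1 ->
  norm (H2_poly (fun m => (v ^ m)%C) D) <= / sqrt (1 - Cmod v ^ 2).
Proof.
intros Hv. pose proof (Cmod_ge_0 v) as V0.
rewrite <- (sqrt_pow2 (norm _)) by apply norm_ge_0.
rewrite <- sqrt_inv. apply sqrt_le_1_alt. rewrite norm_H2_poly_sqr.
rewrite (sum_n_ext _ (fun m => (Cmod v ^ 2) ^ m)).
- apply geom_sum_n_le. split; [apply pow2_ge_0|nra].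
- intros m. rewrite Cmod_pow, <- !pow_mult. f_equal. lia.
Qed.

Lemma norm_H2_scal (k : C) (f : H2) : norm (scal k f) = Cmod k * norm f.
Proof. exact (H2_norm_scal k f). Qed.

Lemma norm_H2_minus_le (f g : H2) : norm (minus f g) <= norm f + norm g.
Proof.
unfold minus. apply Rle_trans with (1 := norm_triangle _ _).
rewrite norm_opp. lra.
Qed.

Section Symbol.

Context (alpha M : R) (c : H2 -> C) (Hc : is_linear c) (HM : 0 < M)
  (Hres : forall (w : C) (f : H2), Cmod w < 1 ->
    Cmod (c f) <= M * Rpower (1 - Cmod w ^ 2) (- ((1 - alpha) / 2))
      * norm (minus f (scal w (shift f)))).

(** The sum on the left is c(P) for w = sz and v = tz, and the estimate for c is applied at w. The
    term 2 s^{D+2} bounds the coefficient w^{D+2} - w v^{D+1} left by truncation. *)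
Lemma symbol_difference_le (s t : R) (z : C) D : 0 <= t <= s -> s < 1 -> Cmod z = 1 ->
  Cmod (Csum (fun m => (c (monomial m) * RtoC (s ^ m - t ^ m) * z ^ m)%C) (S D))
  <= M * Rpower (1 - s ^ 2) (- ((1 - alpha) / 2))
     * ((s - t) / sqrt (1 - t ^ 2) + 2 * s ^ S (S D)).
Proof.
intros Ht Hs Hz. set (w := (RtoC s * z)%C). set (v := (RtoC t * z)%C).
assert (Cw : Cmod w = s) by (unfold w; rewrite Cmod_mult, Cmod_R, Hz, Rabs_right; lra).
assert (Cv : Cmod v = t) by (unfold v; rewrite Cmod_mult, Cmod_R, Hz, Rabs_right; lra).
set (P := H2_poly (fun m => (w ^ m - v ^ m)%C) (S D)).
replace (Csum _ (S D)) with (c P).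
2:{ unfold P. rewrite linear_H2_poly by exact Hc. apply Csum_ext. intros m _.
    unfold w, v. rewrite !Cpow_mult_l, RtoC_minus, !RtoC_pow. ring. }
apply Rle_trans with (1 := Hres w P ltac:(lra)). rewrite Cw.
apply Rmult_le_compat_l.
{ apply Rmult_le_pos; [lra|left; apply exp_pos]. }
unfold P. rewrite resolvent_difference_poly.
apply Rle_trans with (1 := norm_H2_minus_le _ _).
rewrite !norm_H2_scal, norm_shift, norm_monomial, Rmult_1_r.
apply Rplus_le_compat.
- replace (Cmod (w - v)) with (s - t).
  + unfold Rdiv. apply Rmult_le_compat_l; [lra|].
    rewrite <- Cv. apply norm_geom_poly_le. lra.
  + replace (w - v)%C with (RtoC (s - t) * z)%C by (unfold w, v; rewrite RtoC_minus; ring).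
    rewrite Cmod_mult, Cmod_R, Hz, Rabs_right; lra.
- unfold Cminus. apply Rle_trans with (1 := Cmod_triangle _ _).
  rewrite Cmod_opp, Cmod_mult, !Cmod_pow, Cw, Cv.
  pose proof (pow_incr t s (S D) Ht). pose proof (pow_le s (S D) ltac:(lra)).
  change (s ^ S (S D)) with (s * s ^ S D). nra.
Qed.

(** At radii s = e^{-h} and t = s^3 the resolvent weight is of order h^{-(1-alpha)/2} and the norm
    factor of order h^{1/2}, which leaves h^{alpha/2}. The degree D may exceed any given D0, as the
    size of the Hankel form will require. *)
Lemma dyadic_symbol_le (h : R) (D0 : nat) : 0 < h <= 1 -> 0 <= alpha <= 1 ->
  exists D, (D0 <= D)%nat /\ forall z, Cmod z = 1 ->
  Cmod (Csum (fun m => (c (monomial m) * RtoC (exp (- h) ^ m - (exp (- h) ^ 3) ^ m) * z ^ m)%C) D)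
  <= 5 * M * Rpower h (alpha / 2).
Proof.
intros Hh Ha. set (s := exp (- h)).
assert (s0 : 0 < s) by apply exp_pos.
assert (s1 : s < 1) by (rewrite <- exp_0; apply exp_increasing; lra).
(* A scale comparable to 1 - s^2: the next two bounds give d <= 1 - s^2 <= 4d, the lower one using h
   <= 1. *)
set (d := h / 2). assert (d0 : 0 < d) by (unfold d; lra).
assert (Hs2 : s ^ 2 = exp (- (2 * h))).
{ unfold s. simpl. rewrite Rmult_1_r, <- exp_plus. f_equal. ring. }
assert (dl : d <= 1 - s ^ 2).
{ rewrite Hs2, exp_Ropp. pose proof (exp_ineq1_le (2 * h)) as E.
  assert (/ exp (2 * h) <= / (1 + 2 * h)) by (apply Rinv_le_contravar; lra).
  assert (/ (1 + 2 * h) <= 1 - h / 2); [|unfold d; lra].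
  apply (Rmult_le_reg_l (1 + 2 * h)); [lra|]. rewrite Rinv_r by lra. nra. }
assert (du : 1 - s ^ 2 <= 4 * d).
{ rewrite Hs2. pose proof (exp_ineq1_le (- (2 * h))). unfold d. lra. }
assert (t0 : 0 <= s ^ 3 <= s).
{ split; [apply pow_le; lra|]. simpl. nra. }
(* Beyond D1 the truncation term 2 s^{D+2} is below sqrt d; with the 4 sqrt d of [E1] this makes the
   constant 5. *)
destruct (pow_lt_1_zero s ltac:(rewrite Rabs_right; lra) (sqrt d / 2)
  ltac:(pose proof (sqrt_lt_R0 d d0); lra)) as [D1 HD1].
exists (S (D0 + D1)). split; [lia|]. intros z Hz.
apply Rle_trans with (1 := symbol_difference_le s (s ^ 3) z (D0 + D1) t0 s1 Hz).
specialize (HD1 (S (S (D0 + D1))) ltac:(lia)).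
rewrite Rabs_right in HD1 by (apply Rle_ge, pow_le; lra).
(* The numerator is s (1 - s^2) <= 4d, and the denominator is at least sqrt d because s^3 <= s. *)
assert (E1 : (s - s ^ 3) / sqrt (1 - (s ^ 3) ^ 2) <= 4 * sqrt d).
{ assert (Hsq : sqrt d <= sqrt (1 - (s ^ 3) ^ 2)).
  { apply sqrt_le_1_alt. apply Rle_trans with (1 := dl).
    assert ((s ^ 3) ^ 2 <= s ^ 2) by (apply pow_incr; exact t0). lra. }
  pose proof (sqrt_lt_R0 d d0).
  apply Rle_trans with (4 * d / sqrt d).
  - unfold Rdiv. apply Rmult_le_compat; [nra| |simpl; simpl in du; nra|].
    + left. apply Rinv_0_lt_compat. lra.
    + apply Rinv_le_contravar; assumption.
  - right. rewrite <- (sqrt_sqrt d) at 1 by lra. field. lra. }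
assert (E2 : Rpower (1 - s ^ 2) (- ((1 - alpha) / 2)) <= Rpower d (- ((1 - alpha) / 2))).
{ rewrite !Rpower_Ropp. apply Rinv_le_contravar; [apply exp_pos|].
  apply Rle_Rpower_l; lra. }
assert (p0 : 0 < Rpower (1 - s ^ 2) (- ((1 - alpha) / 2))) by apply exp_pos.
apply Rle_trans with (M * Rpower d (- ((1 - alpha) / 2)) * (5 * sqrt d)).
- apply Rmult_le_compat.
  + apply Rmult_le_pos; lra.
  + apply Rplus_le_le_0_compat.
    * apply Rdiv_le_0_compat; [lra|]. apply sqrt_lt_R0.
      assert ((s ^ 3) ^ 2 <= s ^ 2) by (apply pow_incr; exact t0). lra.
    * pose proof (pow_le s (S (S (D0 + D1))) ltac:(lra)). lra.
  + apply Rmult_le_compat_l; lra.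
  + lra.
- rewrite <- (Rpower_sqrt d d0).
  replace (M * Rpower d (- ((1 - alpha) / 2)) * (5 * Rpower d (/ 2)))
    with (5 * M * (Rpower d (- ((1 - alpha) / 2)) * Rpower d (/ 2))) by ring.
  rewrite <- Rpower_plus. replace (- ((1 - alpha) / 2) + / 2) with (alpha / 2) by field.
  apply Rmult_le_compat_l; [lra|].
  apply Rle_Rpower_l; unfold d; lra.
Qed.

End Symbol.

(** * Admissibility below the critical exponent *)

(** Since h <= 1, h(1 + n) <= 1 + hn <= e^{hn}; raising to the power g <= 1 costs at most e^{hn}. *)
Lemma weight_exp_le (h g : R) n : 0 < h <= 1 -> 0 <= g <= 1 ->
  Rpower h g * Rpower (1 + INR n) g * exp (- h) ^ n <= 1.
Proof.
intros Hh Hg. pose proof (pos_INR n) as Hn.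
rewrite Rpower_mult_distr by lra.
assert (E : exp (- h) ^ n = exp (- (h * INR n))).
{ rewrite <- Rpower_pow by apply exp_pos. unfold Rpower. rewrite ln_exp. f_equal. ring. }
rewrite E.
apply Rle_trans with (Rpower (exp (h * INR n)) g * exp (- (h * INR n))).
- apply Rmult_le_compat_r; [left; apply exp_pos|].
  apply Rle_Rpower_l; [lra|]. split; [nra|].
  pose proof (exp_ineq1_le (h * INR n)). nra.
- unfold Rpower. rewrite ln_exp, <- exp_plus, <- exp_0.
  assert (0 <= h * INR n) by nra.
  assert (g * (h * INR n) + - (h * INR n) <= 0) as [L|L] by nra.
  + left. now apply exp_increasing.
  + rewrite L. lra.
Qed.

(** In e^{-h(n+k)} = e^{-hn} e^{-hk} the first factor absorbs the weight (1 + n)^g at the price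
    h^{-g}, and the second only shrinks x_k. What remains is the unweighted form with coefficients
    b. *)
Lemma weighted_hankel_form_le (h g B : R) (b x u : nat -> C) N K D :
  0 < h <= 1 -> 0 <= g <= 1 -> (N + K <= D)%nat ->
  (forall z, Cmod z = 1 -> Cmod (Csum (fun m => (b m * z ^ m)%C) D) <= B) ->
  Cmod (Csum (fun n => (RtoC (Rpower (1 + INR n) g) * u n *
    Csum (fun k => x k * (RtoC (exp (- h) ^ (n + k)) * b (n + k)%nat)) K)%C) N)
  <= B / 2 * Rpower h (- g)
     * (sum_n (fun k => Cmod (x k) ^ 2) K + sum_n (fun n => Cmod (u n) ^ 2) N).
Proof.
intros Hh Hg HD HB. set (s := exp (- h)).
assert (s0 : 0 < s) by apply exp_pos.
assert (s1 : s <= 1).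
{ unfold s. rewrite <- exp_0. left. apply exp_increasing. lra. }
assert (B0 : 0 <= B).
{ apply Rle_trans with (2 := HB (RtoC 1) Cmod_1). apply Cmod_ge_0. }
set (W := fun n => Rpower h g * Rpower (1 + INR n) g * s ^ n).
assert (HW : forall n, 0 <= W n <= 1).
{ intros n. split; [|apply weight_exp_le; assumption].
  unfold W. apply Rmult_le_pos; [apply Rmult_le_pos; left; apply exp_pos|apply pow_le; lra]. }
(* The price of the weight: p compensates the factor h^g that keeps W below 1. *)
set (p := Rpower h (- g)). assert (p0 : 0 < p) by apply exp_pos.
assert (Hp : p * Rpower h g = 1).
{ unfold p. rewrite <- Rpower_plus. replace (- g + g) with 0 by ring. apply Rpower_O; lra. }
set (X := fun k => (x k * RtoC (s ^ k))%C). set (Y := fun n => (RtoC (W n) * u n)%C).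
pose proof (hankel_form_le b X Y N K D B HD HB) as Q.
set (T := Csum _ N) in Q.
match goal with |- Cmod ?t <= _ => replace t with (RtoC p * T)%C end.
2:{ unfold T. rewrite <- Csum_mult_l. apply Csum_ext. intros n _.
    rewrite <- !Csum_mult_l. apply Csum_ext. intros k _. unfold X, Y, W.
    rewrite !RtoC_mult.
    replace (RtoC (s ^ (n + k))) with (RtoC (s ^ n) * RtoC (s ^ k))%C
      by (rewrite <- RtoC_mult, pow_add; reflexivity).
    transitivity ((RtoC p * RtoC (Rpower h g)) * (RtoC (Rpower (1 + INR n) g) * u n
      * (x k * (RtoC (s ^ n) * RtoC (s ^ k) * b (n + k)%nat))))%C; [ring|].
    rewrite <- RtoC_mult, Hp. ring. }
rewrite Cmod_mult, Cmod_R, Rabs_right by lra.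
assert (sum_n (fun k => Cmod (X k) ^ 2) K <= sum_n (fun k => Cmod (x k) ^ 2) K).
{ apply sum_n_le. intros k _. apply pow_incr. split; [apply Cmod_ge_0|].
  unfold X. rewrite Cmod_mult, Cmod_R, Rabs_right by (apply Rle_ge, pow_le; lra).
  assert (s ^ k <= 1) by (rewrite <- (pow1 k); apply pow_incr; lra).
  pose proof (Cmod_ge_0 (x k)). nra. }
assert (sum_n (fun n => Cmod (Y n) ^ 2) N <= sum_n (fun n => Cmod (u n) ^ 2) N).
{ apply sum_n_le. intros n _. apply pow_incr. split; [apply Cmod_ge_0|].
  unfold Y. rewrite Cmod_mult, Cmod_R, Rabs_right by (apply Rle_ge, HW).
  pose proof (HW n). pose proof (Cmod_ge_0 (u n)). nra. }
apply (Rmult_le_compat_l p) in Q; [|lra].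
apply Rle_trans with (1 := Q).
rewrite (Rmult_comm (B / 2) p), Rmult_assoc. apply Rmult_le_compat_l; [lra|].
apply Rmult_le_compat_l; lra.
Qed.

Lemma Rpower_pow_l (x g : R) n : 0 < x -> Rpower (x ^ n) g = Rpower x g ^ n.
Proof.
intros Hx. rewrite <- Rpower_pow by exact Hx.
rewrite <- (Rpower_pow n (Rpower x g)) by apply exp_pos.
rewrite !Rpower_mult. f_equal. ring.
Qed.

Lemma is_lim_seq_sum_n (F : nat -> nat -> R) (l : nat -> R) n :
  (forall k, is_lim_seq (fun J => F J k) (l k)) ->
  is_lim_seq (fun J => sum_n (F J) n) (sum_n l n).
Proof.
intros H. induction n as [|n IH].
- rewrite sum_O. apply (is_lim_seq_ext (fun J => F J 0%nat)); [|apply H].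
  intros J. now rewrite sum_O.
- rewrite sum_Sn. apply (is_lim_seq_ext (fun J => sum_n (F J) n + F J (S n))).
  + intros J. now rewrite sum_Sn.
  + now apply is_lim_seq_plus'.
Qed.

Lemma is_lim_seq_pow (a : nat -> R) (l : R) m :
  is_lim_seq a l -> is_lim_seq (fun J => a J ^ m) (l ^ m).
Proof.
intros H. apply (is_lim_seq_continuous (fun y => y ^ m)); [|exact H].
apply derivable_continuous_pt, derivable_pt_pow.
Qed.

Definition dyadic_radius (J : nat) : R := exp (- (/ 2) ^ J).

Lemma dyadic_radius_lim : is_lim_seq dyadic_radius 1.
Proof.
unfold dyadic_radius. rewrite <- exp_0. apply (is_lim_seq_continuous exp).
- apply derivable_continuous_pt, derivable_pt_exp.
- replace (Finite 0) with (Rbar_opp 0) by (simpl; f_equal; ring).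
  apply (is_lim_seq_opp (fun J => (/ 2) ^ J) 0). apply is_lim_seq_geom. rewrite Rabs_right; lra.
Qed.

Lemma dyadic_radius_S J : dyadic_radius (S J) ^ 2 = dyadic_radius J.
Proof.
unfold dyadic_radius. simpl. rewrite Rmult_1_r, <- exp_plus. f_equal. field.
Qed.

Lemma half_pow_bounds J : 0 < (/ 2) ^ J <= 1.
Proof.
split; [apply pow_lt; lra|]. rewrite <- (pow1 J). apply pow_incr; lra.
Qed.

(** * Dyadic decomposition of the weighted Hankel form *)

Section Admissible.

Context (alpha beta M Mc : R) (c : H2 -> C) (Hc : is_linear c) (HM : 0 < M)
  (HMc : 0 < Mc) (Hbound : forall f, Cmod (c f) <= Mc * norm f)
  (Hres : forall (w : C) (f : H2), Cmod w < 1 ->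
    Cmod (c f) <= M * Rpower (1 - Cmod w ^ 2) (- ((1 - alpha) / 2))
      * norm (minus f (scal w (shift f))))
  (Hbeta : 0 <= beta < alpha) (Halpha : alpha < 1).

Let weight n := Rpower (1 + INR n) (beta / 2).
Let ratio := Rpower (/ 2) ((alpha - beta) / 2).
Let c0 := Mc / (1 - dyadic_radius 0 ^ 3).
Let admissibility_const := c0 + 5 * M / (1 - ratio).

(** The weighted sequence c(S^n x) tested against a dual sequence u. The multiplier q acts on the
    coefficients c_m, and the form is additive in q: q = 1 is the form to be bounded, and the dyadic
    pieces are other choices of q. *)
Let form (q : nat -> R) (u x : nat -> C) N K :=
  Csum (fun n => (RtoC (weight n) * u n *
    Csum (fun k => x k * (RtoC (q (n + k)%nat) * c (monomial (n + k)))) K)%C) N.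

Let energy (u x : nat -> C) N K :=
  sum_n (fun k => Cmod (x k) ^ 2) K + sum_n (fun n => Cmod (u n) ^ 2) N.

Lemma form_plus q1 q2 u x N K :
  form (fun m => q1 m + q2 m) u x N K = (form q1 u x N K + form q2 u x N K)%C.
Proof.
unfold form. rewrite <- Csum_plus. apply Csum_ext. intros n _.
rewrite <- Cmult_plus_distr_l, <- Csum_plus. f_equal. apply Csum_ext. intros k _.
rewrite RtoC_plus. ring.
Qed.

Lemma ratio_bounds : 0 < ratio < 1.
Proof.
unfold ratio. split; [apply exp_pos|].
apply Rlt_le_trans with (Rpower 1 ((alpha - beta) / 2)).
- apply Rlt_Rpower_l; lra.
- right. unfold Rpower. rewrite ln_1, Rmult_0_r. apply exp_0.
Qed.

Lemma energy_nonneg u x N K : 0 <= energy u x N K.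
Proof. apply Rplus_le_le_0_compat; apply sum_n_nonneg; intros; apply pow2_ge_0. Qed.

Lemma dyadic_radius_bounds J : 0 < dyadic_radius J < 1.
Proof.
unfold dyadic_radius. split; [apply exp_pos|]. rewrite <- exp_0. apply exp_increasing.
pose proof (half_pow_bounds J). lra.
Qed.

Lemma c0_pos : 0 < c0.
Proof.
pose proof (dyadic_radius_bounds 0) as H. unfold c0. apply Rdiv_lt_0_compat; [exact HMc|].
set (s := dyadic_radius 0) in *. assert (s ^ 3 < 1); [|lra]. simpl. nra.
Qed.

(** Here h = 1, so the weight costs nothing. In s^{4m} = s^m s^{3m} the second factor makes the
    symbol an absolutely convergent geometric series, as |c_m| <= Mc. *)
Lemma form_initial_le u x N K :
  Cmod (form (fun m => dyadic_radius 0 ^ (4 * m)) u x N K) <= c0 / 2 * energy u x N K.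
Proof.
pose proof (dyadic_radius_bounds 0) as Hs. set (s := dyadic_radius 0) in *.
assert (s3 : 0 <= s ^ 3 < 1).
{ split; [apply pow_le; lra|]. simpl. nra. }
pose proof (weighted_hankel_form_le 1 (beta / 2) c0
  (fun m => (RtoC ((s ^ 3) ^ m) * c (monomial m))%C) x u N K (N + K)
  ltac:(lra) ltac:(lra) (le_n _)) as Q.
replace (Rpower 1 (- (beta / 2))) with 1 in Q
  by (unfold Rpower; rewrite ln_1, Rmult_0_r, exp_0; reflexivity).
rewrite Rmult_1_r in Q.
unfold energy. eapply Rle_trans; [|apply Q].
- right. f_equal. unfold form. apply Csum_ext. intros n _. f_equal. apply Csum_ext.
  intros k _. f_equal. rewrite Cmult_assoc, <- RtoC_mult. do 2 f_equal.
  replace (exp (- (1))) with s by (unfold s, dyadic_radius; now rewrite pow_O).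
  rewrite <- pow_mult, <- pow_add. reflexivity.
- intros z Hz. apply Rle_trans with (1 := Cmod_Csum_le _ _).
  apply Rle_trans with (sum_n (fun m => Mc * (s ^ 3) ^ m) (N + K)).
  + apply sum_n_le. intros m _. rewrite !Cmod_mult, Cmod_pow, Hz, pow1, Rmult_1_r.
    rewrite Cmod_R, Rabs_right by (apply Rle_ge, pow_le; lra).
    rewrite Rmult_comm. apply Rmult_le_compat_r; [apply pow_le; lra|].
    pose proof (Hbound (monomial m)). rewrite norm_monomial in *. lra.
  + rewrite sum_n_scal_R. unfold c0, Rdiv. apply Rmult_le_compat_l; [lra|].
    apply geom_sum_n_le. exact s3.
Qed.

(** In s^{2m} - s^{4m} = s^m (s^m - s^{3m}) the first factor pays for the weight, at the price
    h^{-beta/2}, and the symbol of the rest gains h^{alpha/2}. With h = 2^{-J} the product is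
    [ratio ^ J]. *)
Lemma form_block_le u x N K J :
  Cmod (form (fun m => dyadic_radius J ^ (2 * m) - dyadic_radius J ^ (4 * m)) u x N K)
  <= 5 * M / 2 * ratio ^ J * energy u x N K.
Proof.
set (h := (/ 2) ^ J). pose proof (half_pow_bounds J : 0 < h <= 1) as Hh.
destruct (dyadic_symbol_le alpha M c Hc HM Hres h (N + K) Hh ltac:(lra)) as [D [HD HB]].
set (s := exp (- h)) in *. change (dyadic_radius J) with s.
pose proof (weighted_hankel_form_le h (beta / 2) _
  (fun m => (c (monomial m) * RtoC (s ^ m - (s ^ 3) ^ m))%C) x u N K D
  Hh ltac:(lra) HD HB) as Q.
replace (5 * M / 2 * ratio ^ J) with
  (5 * M * Rpower h (alpha / 2) / 2 * Rpower h (- (beta / 2))).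
- eapply Rle_trans; [|exact Q].
  right. f_equal. unfold form. apply Csum_ext. intros n _. f_equal. apply Csum_ext.
  intros k _. f_equal. fold s.
  rewrite (Cmult_comm (c _)), Cmult_assoc, <- RtoC_mult. do 2 f_equal.
  rewrite Rmult_minus_distr_l, <- pow_mult, <- !pow_add. f_equal; f_equal; lia.
- unfold ratio. rewrite <- Rpower_pow_l by lra. fold h.
  replace ((alpha - beta) / 2) with (alpha / 2 + - (beta / 2)) by field.
  rewrite Rpower_plus. field.
Qed.

(** Since s_{J+1}^{4m} = s_J^{2m}, passing from J to J + 1 adds exactly one block. The bound is the
    partial geometric sum in closed form. *)
Lemma form_dyadic_le u x N K J :
  Cmod (form (fun m => dyadic_radius J ^ (4 * m)) u x N K)
  <= (c0 + 5 * M * (1 - ratio ^ J) / (1 - ratio)) / 2 * energy u x N K.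
Proof.
pose proof ratio_bounds as Hr. pose proof (energy_nonneg u x N K) as HE.
induction J as [|J IH].
- replace (1 - ratio ^ 0) with 0 by (simpl; ring).
  replace (c0 + 5 * M * 0 / (1 - ratio)) with c0 by (field; lra).
  apply form_initial_le.
- set (a := form _ _ _ _ _) in *. pose proof (form_block_le u x N K J) as Q.
  replace (form (fun m => dyadic_radius (S J) ^ (4 * m)) u x N K)
    with (a + form (fun m => (dyadic_radius J ^ (2 * m) - dyadic_radius J ^ (4 * m))%R) u x N K)%C.
  + apply Rle_trans with (1 := Cmod_triangle _ _).
    apply Rle_trans with (1 := Rplus_le_compat _ _ _ _ IH Q).
    right. simpl. field. lra.
  + unfold a. rewrite <- form_plus. unfold form. apply Csum_ext. intros n _. f_equal.
    apply Csum_ext. intros k _. do 3 f_equal.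
    replace (4 * (n + k))%nat with (2 * (2 * (n + k)))%nat at 3 by lia.
    rewrite (pow_mult (dyadic_radius (S J)) 2), dyadic_radius_S. ring.
Qed.

(** The previous bound is uniform in J. For fixed N and K the multiplier 1 - s_J^{4m} of the
    remainder tends to 0 at the finitely many m that occur. *)
Lemma form_le u x N K :
  Cmod (form (fun _ => 1) u x N K) <= admissibility_const / 2 * energy u x N K.
Proof.
pose proof ratio_bounds as Hr. pose proof (energy_nonneg u x N K) as HE.
(* A termwise majorant of the remainder, a finite sum of null sequences in J. *)
set (R := fun J => sum_n (fun n => weight n * Cmod (u n) *
   sum_n (fun k => Cmod (x k) * ((1 - dyadic_radius J ^ (4 * (n + k)))
     * Cmod (c (monomial (n + k))))) K) N).
assert (HR : is_lim_seq R 0).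
{ replace 0 with (sum_n (fun n => weight n * Cmod (u n) *
    sum_n (fun k => Cmod (x k) * ((1 - 1 ^ (4 * (n + k)))
     * Cmod (c (monomial (n + k))))) K) N).
  - apply is_lim_seq_sum_n. intros n. apply is_lim_seq_mult'; [apply is_lim_seq_const|].
    apply is_lim_seq_sum_n. intros k. apply is_lim_seq_mult'; [apply is_lim_seq_const|].
    apply is_lim_seq_mult'; [|apply is_lim_seq_const].
    apply is_lim_seq_minus'; [apply is_lim_seq_const|].
    apply is_lim_seq_pow, dyadic_radius_lim.
  - transitivity (sum_n (fun _ => 0) N); [|rewrite sum_n_const; apply Rmult_0_r].
    apply sum_n_ext. intros n. rewrite (sum_n_ext _ (fun _ => 0)).
    + rewrite sum_n_const, Rmult_0_r. apply Rmult_0_r.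
    + intros k. rewrite pow1, Rminus_diag, Rmult_0_l. apply Rmult_0_r. }
assert (Hlim : is_lim_seq (fun J => admissibility_const / 2 * energy u x N K + R J)
  (admissibility_const / 2 * energy u x N K + 0)).
{ apply is_lim_seq_plus'; [apply is_lim_seq_const|exact HR]. }
rewrite Rplus_0_r in Hlim.
refine (is_lim_seq_le (fun _ => _) _ (Finite _) (Finite _) _ (is_lim_seq_const _) Hlim).
intros J.
replace (form (fun _ => 1) u x N K) with
  (form (fun m => dyadic_radius J ^ (4 * m) + (1 - dyadic_radius J ^ (4 * m))) u x N K).
2:{ unfold form. apply Csum_ext. intros n _. f_equal. apply Csum_ext. intros k _.
    do 3 f_equal. ring. }
rewrite form_plus. apply Rle_trans with (1 := Cmod_triangle _ _).
apply Rplus_le_compat.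
- apply Rle_trans with (1 := form_dyadic_le u x N K J).
  apply Rmult_le_compat_r; [exact HE|]. unfold admissibility_const.
  assert (5 * M * (1 - ratio ^ J) / (1 - ratio) <= 5 * M / (1 - ratio)); [|lra].
  unfold Rdiv. apply Rmult_le_compat_r; [left; apply Rinv_0_lt_compat; lra|].
  pose proof (pow_le ratio J ltac:(lra)). nra.
- apply Rle_trans with (1 := Cmod_Csum_le _ _). apply sum_n_le. intros n _.
  assert (W0 : 0 < weight n) by apply exp_pos.
  rewrite !Cmod_mult, Cmod_R, Rabs_right by lra.
  apply Rmult_le_compat_l; [apply Rmult_le_pos; [lra|apply Cmod_ge_0]|].
  apply Rle_trans with (1 := Cmod_Csum_le _ _). apply sum_n_le. intros k _.
  rewrite !Cmod_mult, Cmod_R, Rabs_right; [lra|].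
  pose proof (dyadic_radius_bounds J).
  assert (dyadic_radius J ^ (4 * (n + k)) <= 1); [|lra].
  rewrite <- (pow1 (4 * (n + k))). apply pow_incr. lra.
Qed.

Lemma admissibility_const_pos : 0 < admissibility_const.
Proof.
unfold admissibility_const. pose proof c0_pos. pose proof ratio_bounds.
assert (0 < 5 * M / (1 - ratio)) by (apply Rdiv_lt_0_compat; lra). lra.
Qed.

Lemma weight_sqr n : weight n ^ 2 = Rpower (1 + INR n) beta.
Proof.
unfold weight. simpl. rewrite Rmult_1_r, <- Rpower_plus. f_equal. field.
Qed.

Lemma linear_iter_shift_poly x n K :
  c (Nat.iter n shift (H2_poly x K)) = Csum (fun k => (x k * c (monomial (n + k)))%C) K.
Proof.
rewrite (linear_H2_poly (fun f => c (Nat.iter n shift f)) x K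
  (is_linear_comp _ _ (is_linear_iter_shift n) Hc)).
apply Csum_ext. intros k _. now rewrite iter_shift_monomial.
Qed.

(** Duality: testing with u proportional to the conjugate of the weighted sequence, scaled by 1/A,
    turns the form bound into V/A <= (A/2)(X + V/A^2), where X is the squared norm. The V term on
    the right is half of the left side and is absorbed, leaving V <= A^2 X. *)
Lemma admissible_poly x N K :
  sum_n (fun n => Rpower (1 + INR n) beta
    * Cmod (c (Nat.iter n shift (H2_poly x K))) ^ 2) N
  <= admissibility_const ^ 2 * norm (H2_poly x K) ^ 2.
Proof.
pose proof admissibility_const_pos as HA. set (A := admissibility_const) in *.
set (v := fun n => c (Nat.iter n shift (H2_poly x K))).
(* For this [u] the form equals [V / A], where [V] is the sum to be bounded. *)
set (u := fun n => (RtoC (weight n / A) * Cconj (v n))%C).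
pose proof (form_le u x N K) as Q. fold A in Q. unfold energy in Q.
rewrite norm_H2_poly_sqr.
set (X := sum_n (fun k => Cmod (x k) ^ 2) K) in *.
set (V := sum_n (fun n => Rpower (1 + INR n) beta * Cmod (v n) ^ 2) N).
assert (V0 : 0 <= V).
{ apply sum_n_nonneg. intros n. apply Rmult_le_pos; [left; apply exp_pos|apply pow2_ge_0]. }
assert (E1 : form (fun _ => 1) u x N K = RtoC (V / A)).
{ unfold form, V. unfold Rdiv. rewrite Rmult_comm, <- sum_n_scal_R, RtoC_sum_n.
  apply Csum_ext. intros n _. rewrite <- weight_sqr.
  replace (Csum _ K) with (v n).
  - rewrite !RtoC_mult, Cmod2_conj. unfold u, Rdiv.
    rewrite !RtoC_mult. simpl (weight n ^ 2). rewrite !RtoC_mult. ring.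
  - unfold v. rewrite linear_iter_shift_poly. apply Csum_ext. intros k _. ring. }
assert (E2 : sum_n (fun n => Cmod (u n) ^ 2) N = V / A ^ 2).
{ unfold V, Rdiv. rewrite Rmult_comm, <- sum_n_scal_R. apply sum_n_ext. intros n.
  change (@eq R (Cmod (u n) ^ 2) (/ A ^ 2 * (Rpower (1 + INR n) beta * Cmod (v n) ^ 2))).
  unfold u. rewrite Cmod_mult, Cmod_conj, Cmod_R, Rabs_right, <- weight_sqr.
  - field. lra.
  - left. apply Rdiv_lt_0_compat; [apply exp_pos|lra]. }
rewrite E1, E2, Cmod_R, Rabs_right in Q
  by (apply Rle_ge, Rdiv_le_0_compat; lra).
assert (V / A - A / 2 * (V / A ^ 2) = V / (2 * A)) by (field; lra).
assert (HV : V / (2 * A) <= A / 2 * X) by lra.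
change (V <= A ^ 2 * X).
apply (Rmult_le_reg_l (/ (2 * A))); [apply Rinv_0_lt_compat; lra|].
replace (/ (2 * A) * V) with (V / (2 * A)) by (field; lra).
replace (/ (2 * A) * (A ^ 2 * X)) with (A / 2 * X) by (field; lra).
exact HV.
Qed.

(** Density of polynomials: for fixed N the left side is continuous in f, and truncating the Taylor
    series does not increase the norm. *)
Lemma admissible_partial (f : H2) N :
  sum_n (fun n => Rpower (1 + INR n) beta * Cmod (c (Nat.iter n shift f)) ^ 2) N
  <= admissibility_const ^ 2 * norm f ^ 2.
Proof.
set (fK := H2_poly (H2_coef f)).
assert (L : is_lim_seq (fun K => sum_n (fun n => Rpower (1 + INR n) beta
    * Cmod (c (Nat.iter n shift (fK K))) ^ 2) N)
  (sum_n (fun n => Rpower (1 + INR n) beta * Cmod (c (Nat.iter n shift f)) ^ 2) N)).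
{ apply is_lim_seq_sum_n. intros n.
  apply is_lim_seq_mult'; [apply is_lim_seq_const|]. apply is_lim_seq_pow.
  set (a := c (Nat.iter n shift f)).
  (* The constant is Mc for every n because S^n is isometric. *)
  assert (Hd : forall K, Cmod (a - c (Nat.iter n shift (fK K)))%C <= Mc * norm (minus f (fK K))).
  { intros K. rewrite <- (norm_iter_shift n (minus f (fK K))).
    rewrite (linear_minus _ f (fK K) (is_linear_iter_shift n)).
    apply Rle_trans with (2 := Hbound _). right. f_equal. symmetry.
    exact (linear_minus c _ _ Hc). }
  assert (L0 : is_lim_seq (fun K => Mc * norm (minus f (fK K))) 0).
  { replace (Finite 0) with (Finite (Mc * 0)) by (f_equal; ring).
    apply is_lim_seq_mult'; [apply is_lim_seq_const|apply H2_poly_coef_lim]. }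
  apply (is_lim_seq_le_le (fun K => Cmod a - Mc * norm (minus f (fK K))) _
    (fun K => Cmod a + Mc * norm (minus f (fK K)))).
  - intros K. specialize (Hd K). set (b := c (Nat.iter n shift (fK K))) in *.
    pose proof (Cmod_triangle (a - b) b) as T1.
    replace (a - b + b)%C with a in T1 by ring.
    pose proof (Cmod_triangle (- (a - b)) a) as T2.
    replace (- (a - b) + a)%C with b in T2 by ring. rewrite Cmod_opp in T2. lra.
  - replace (Finite (Cmod a)) with (Finite (Cmod a - 0)) by (f_equal; ring).
    apply is_lim_seq_minus'; [apply is_lim_seq_const|exact L0].
  - replace (Finite (Cmod a)) with (Finite (Cmod a + 0)) by (f_equal; ring).
    apply is_lim_seq_plus'; [apply is_lim_seq_const|exact L0]. }
refine (is_lim_seq_le _ (fun _ => _) (Finite _) (Finite _) _ L (is_lim_seq_const _)).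
intros K. apply Rle_trans with (1 := admissible_poly (H2_coef f) N K).
apply Rmult_le_compat_l; [apply pow2_ge_0|].
rewrite norm_H2_poly_sqr, norm_H2_sqr.
exact (@sum_n_le_Series (fun n => Cmod (H2_coef f n) ^ 2) K
  (square_nonneg _) (proj1 (H2_coefP f))).
Qed.

End Admissible.

Lemma resolvent_condition_admissible alpha beta (c : H2 -> C) :
  0 <= beta < alpha -> alpha < 1 -> is_linear c ->
  resolvent_condition alpha shift c -> discrete_admissible beta shift c.
Proof.
intros Hb Ha Hc Hr.
destruct (resolvent_condition_bound alpha c Hc Hr) as [M [HM Hres]].
destruct (linear_norm c Hc) as [Mc [HMc Hbound]].
pose proof (admissible_partial alpha beta M Mc c Hc HM HMc Hbound Hres Hb Ha) as P.
pose proof (admissibility_const_pos alpha beta M Mc HM HMc Hb) as A0.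
cbv zeta in P, A0.
match type of A0 with 0 < ?a => set (A := a) in * end.
exists (A ^ 2). split; [apply pow_lt; exact A0|]. intros f.
apply (@ex_series_nonneg (fun n => Rpower (1 + INR n) beta * Cmod (c (Nat.iter n shift f)) ^ 2)).
- intros n. apply Rmult_le_pos; [left; apply exp_pos|apply pow2_ge_0].
- exact (P f).
Qed.

(** * Lacunary functionals *)

(** The Cauchy-Schwarz inequality for the coefficient, which is the sum of w^{n-k} a_k over k <= n,
    proved along the recursion. *)
Lemma Cmod_resolvent_coef_sqr_le (w : C) (a : nat -> C) n :
  Cmod (resolvent_coef w a n) ^ 2
  <= sum_n (fun k => (Cmod w ^ 2) ^ k) n * sum_n (fun k => Cmod (a k) ^ 2) n.
Proof.
assert (G : forall n, sum_n (fun k => (Cmod w ^ 2) ^ k) (S n)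
  = 1 + Cmod w ^ 2 * sum_n (fun k => (Cmod w ^ 2) ^ k) n).
{ induction n0 as [|m IH].
  - rewrite sum_Sn, !sum_O. unfold plus; simpl. ring.
  - rewrite sum_Sn. rewrite IH at 1. rewrite (sum_Sn _ m). unfold plus; simpl. ring. }
induction n as [|n IH].
- rewrite !sum_O. change (resolvent_coef w a 0) with (a 0%nat). simpl. lra.
- rewrite G, (sum_Sn (fun k => Cmod (a k) ^ 2)).
  change (resolvent_coef w a (S n)) with (w * resolvent_coef w a n + a (S n))%C.
  pose proof (Cmod_triangle (w * resolvent_coef w a n) (a (S n))) as T.
  rewrite Cmod_mult in T.
  pose proof (Cmod_ge_0 (w * resolvent_coef w a n + a (S n))).
  set (b := Cmod (resolvent_coef w a n)) in *. set (x := Cmod (a (S n))) in *.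
  set (r := Cmod w) in *.
  set (g := sum_n (fun k => (r ^ 2) ^ k) n) in *.
  set (s := sum_n (fun k => Cmod (a k) ^ 2) n) in *.
  assert (g0 : 0 <= g) by (apply sum_n_nonneg; intros; apply pow_le, pow2_ge_0).
  assert (s0 : 0 <= s) by (apply sum_n_nonneg; intros; apply pow2_ge_0).
  apply Rle_trans with ((r * b + x) ^ 2); [apply pow_incr; lra|].
  change (plus s (x ^ 2)) with (s + x ^ 2).
  (* Cauchy-Schwarz: [2 r b x <= 2 sqrt (r^2 g x^2 * s) <= r^2 g x^2 + s] *)
  assert (P : 0 <= r ^ 2 * g * x ^ 2).
  { apply Rmult_le_pos; [apply Rmult_le_pos; [apply pow2_ge_0|exact g0]|apply pow2_ge_0]. }
  assert (K : 2 * (r * b * x) <= r ^ 2 * g * x ^ 2 + s).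
  { apply Rle_trans with (2 * (sqrt (r ^ 2 * g * x ^ 2) * sqrt s)).
    - apply Rmult_le_compat_l; [lra|]. rewrite <- sqrt_mult_alt by exact P.
      apply Rsqr_incr_0_var; [|apply sqrt_pos].
      rewrite Rsqr_sqrt by (apply Rmult_le_pos; assumption).
      unfold Rsqr. pose proof (pow2_ge_0 (r * x)). nra.
    - pose proof (pow2_ge_0 (sqrt (r ^ 2 * g * x ^ 2) - sqrt s)).
      pose proof (sqrt_sqrt _ P). pose proof (sqrt_sqrt _ s0). nra. }
  pose proof (pow2_ge_0 r). nra.
Qed.

Lemma H2_coef_disc_resolvent (w : C) (f : H2) : Cmod w < 1 ->
  H2_coef (disc_resolvent shift w f) = resolvent_coef (Cconj w) (H2_coef f).
Proof.
intros Hw. assert (Hw' : Cmod (Cconj w) < 1) by now rewrite Cmod_conj.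
unfold disc_resolvent. rewrite (op_inv_correct (H2_resolventP Hw')).
exact (H2_coef_unique (f := H2_resolvent Hw' f) (has_coef_resolvent Hw' (H2_coefP f))).
Qed.

(** The geometric sum is kept unevaluated because it has two competing bounds, n + 1 and 1 / (1 -
    |w|^2), and both are used. *)
Lemma Cmod_H2_coef_resolvent_le (w : C) (f : H2) n : Cmod w < 1 ->
  Cmod (H2_coef (disc_resolvent shift w f) n)
    <= sqrt (sum_n (fun k => (Cmod w ^ 2) ^ k) n) * norm f.
Proof.
intros Hw. rewrite (H2_coef_disc_resolvent w f Hw).
rewrite <- (sqrt_pow2 (Cmod _)) by apply Cmod_ge_0.
rewrite <- (sqrt_pow2 (norm f)) by apply norm_ge_0.
assert (G0 : 0 <= sum_n (fun k => (Cmod w ^ 2) ^ k) n)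
  by (apply sum_n_nonneg; intros; apply pow_le, pow2_ge_0).
rewrite <- sqrt_mult_alt by exact G0.
apply sqrt_le_1_alt. apply Rle_trans with (1 := Cmod_resolvent_coef_sqr_le _ _ _).
rewrite Cmod_conj. apply Rmult_le_compat_l; [exact G0|]. rewrite norm_H2_sqr.
exact (@sum_n_le_Series (fun n => Cmod (H2_coef f n) ^ 2) n
  (square_nonneg _) (proj1 (H2_coefP f))).
Qed.

Lemma abs_Series_le (u v : nat -> R) : (forall n, Rabs (u n) <= v n) -> ex_series v ->
  ex_series u /\ Rabs (Series u) <= Series v.
Proof.
intros H Hv.
assert (Hu : ex_series (fun n => Rabs (u n))).
{ apply (ex_series_le (V := R_CompleteNormedModule) _ v); [|exact Hv].
  intros n. change (Rabs (Rabs (u n)) <= v n). now rewrite Rabs_Rabsolu. }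
split; [now apply ex_series_Rabs|].
apply Rle_trans with (1 := Series_Rabs _ Hu). apply Series_le; [|exact Hv].
intros n. split; [apply Rabs_pos|apply H].
Qed.

(** Real and imaginary parts are summed separately because [Series] is real-valued; the value is the
    sum of q^j f_{2^j}. *)
Definition lacunary (q : R) (f : H2) : C :=
  (Series (fun j => q ^ j * Re (H2_coef f (2 ^ j))),
   Series (fun j => q ^ j * Im (H2_coef f (2 ^ j)))).

Lemma im_le_Cmod (z : C) : Rabs (Im z) <= Cmod z.
Proof. apply Rle_trans with (2 := Rmax_Cmod z). apply Rmax_r. Qed.

Lemma Cmod_le_Rabs (z : C) : Cmod z <= Rabs (Re z) + Rabs (Im z).
Proof.
replace z with (RtoC (Re z) + Ci * RtoC (Im z))%C at 1.
- apply Rle_trans with (1 := Cmod_triangle _ _).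
  rewrite Cmod_mult, Cmod_Ci, Rmult_1_l, !Cmod_R. lra.
- apply injective_projections; simpl; unfold Re, Im; ring.
Qed.

Section Lacunary.

Context (q : R) (Hq : 0 < q < 1).

Lemma ex_series_lacunary (f : H2) (P : C -> R) :
  (forall z, Rabs (P z) <= Cmod z) -> ex_series (fun j => q ^ j * P (H2_coef f (2 ^ j)%nat)).
Proof.
intros HP. apply (abs_Series_le _ (fun j => norm f * q ^ j)).
- intros j. rewrite Rabs_mult, Rabs_right by (apply Rle_ge, pow_le; lra).
  rewrite Rmult_comm. apply Rmult_le_compat_r; [apply pow_le; lra|].
  apply Rle_trans with (1 := HP _).
  exact (Cmod_le_l2_norm (2 ^ j) (proj1 (H2_coefP f))).
- apply (ex_series_scal (V := R_NormedModule)). apply ex_series_geom.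
  rewrite Rabs_right; lra.
Qed.

(** The factor 2 comes from bounding the real and imaginary parts separately. The majorant m is
    constant for boundedness of the functional and depends on j for the resolvent estimate. *)
Lemma Cmod_lacunary_le (f : H2) (m : nat -> R) (B : R) :
  (forall j, Cmod (H2_coef f (2 ^ j)) <= m j) ->
  (forall n, sum_n (fun j => q ^ j * m j) n <= B) ->
  Cmod (lacunary q f) <= 2 * B.
Proof.
intros Hm HB.
destruct (@ex_series_nonneg (fun j => q ^ j * m j) B) as [E1 E2]; [|exact HB|].
{ intros j. apply Rmult_le_pos; [apply pow_le; lra|].
  apply Rle_trans with (2 := Hm j). apply Cmod_ge_0. }
assert (K : forall P : C -> R, (forall z, Rabs (P z) <= Cmod z) ->
  Rabs (Series (fun j => q ^ j * P (H2_coef f (2 ^ j)%nat))) <= B).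
{ intros P HP. apply Rle_trans with (2 := E2).
  apply (abs_Series_le _ (fun j => q ^ j * m j)); [|exact E1].
  intros j. rewrite Rabs_mult, Rabs_right by (apply Rle_ge, pow_le; lra).
  apply Rmult_le_compat_l; [apply pow_le; lra|].
  apply Rle_trans with (1 := HP _), Hm. }
assert (Rabs (Re (lacunary q f)) <= B) by exact (K Re re_le_Cmod).
assert (Rabs (Im (lacunary q f)) <= B) by exact (K Im im_le_Cmod).
pose proof (Cmod_le_Rabs (lacunary q f)). lra.
Qed.

Lemma is_linear_lacunary : is_linear (lacunary q).
Proof.
split.
- intros f g. change (lacunary q (H2_plus f g) = (lacunary q f + lacunary q g)%C).
  unfold lacunary. rewrite H2_coef_plus. apply injective_projections; simpl;
    rewrite <- Series_plus by (apply ex_series_lacunary; exact re_le_Cmod || exact im_le_Cmod);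
    apply Series_ext; intros j; unfold Re, Im; simpl; ring.
- intros k f. change (lacunary q (H2_scal k f) = (k * lacunary q f)%C).
  assert (ER := ex_series_lacunary f Re re_le_Cmod).
  assert (EI := ex_series_lacunary f Im im_le_Cmod).
  unfold lacunary. rewrite H2_coef_scal. apply injective_projections; simpl;
    rewrite <- !Series_scal_l.
  + rewrite <- Series_minus by (apply (ex_series_scal (V := R_NormedModule)); assumption).
    apply Series_ext. intros j. unfold Re, Im; simpl; ring.
  + rewrite <- Series_plus by (apply (ex_series_scal (V := R_NormedModule)); assumption).
    apply Series_ext. intros j. unfold Re, Im; simpl; ring.
- exists (2 * / (1 - q)). split.
  { assert (0 < / (1 - q)) by (apply Rinv_0_lt_compat; lra). lra. }
  intros f. change (Cmod (lacunary q f) <= 2 * / (1 - q) * norm f).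
  rewrite Rmult_assoc. apply (Cmod_lacunary_le f (fun _ => norm f)).
  + intros j. exact (Cmod_le_l2_norm (2 ^ j) (proj1 (H2_coefP f))).
  + intros n. rewrite (sum_n_ext _ (fun j => norm f * q ^ j)) by (intros; apply Rmult_comm).
    rewrite sum_n_scal_R, Rmult_comm. apply Rmult_le_compat_r; [apply norm_ge_0|].
    apply geom_sum_n_le. lra.
Qed.

Lemma lacunary_monomial j : lacunary q (monomial (2 ^ j)) = RtoC (q ^ j).
Proof.
assert (K : forall x : R, Series (fun i => q ^ i * (if (2 ^ i =? 2 ^ j)%nat then x else 0))
  = q ^ j * x).
{ intros x. apply is_series_unique.
  replace (q ^ j * x) with
    (sum_n (fun i => q ^ i * (if (2 ^ i =? 2 ^ j)%nat then x else 0)) j).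
  - apply is_series_finite_support. intros i Hi.
    destruct (Nat.eqb_spec (2 ^ i) (2 ^ j)) as [E|_]; [|ring].
    apply Nat.pow_inj_r in E; lia.
  - rewrite (sum_n_ext_loc _ (fun i => if (i =? j)%nat then q ^ j * x else 0)).
    + apply RtoC_inj. rewrite RtoC_sum_n.
      rewrite (Csum_ext _ (fun i => if (i =? j)%nat then RtoC (q ^ j * x) else RtoC 0)).
      * rewrite (Csum_delta (fun _ => RtoC (q ^ j * x))).
        now rewrite Nat.leb_refl.
      * intros i _. now destruct (i =? j)%nat.
    + intros i _. destruct (Nat.eqb_spec i j) as [->|N].
      * now rewrite Nat.eqb_refl.
      * destruct (Nat.eqb_spec (2 ^ i) (2 ^ j)) as [E|_]; [|apply Rmult_0_r].
        apply Nat.pow_inj_r in E; lia. }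
unfold lacunary, RtoC. f_equal.
- rewrite <- (Rmult_1_r (q ^ j)), <- K. apply Series_ext. intros i.
  rewrite H2_coef_monomial. now destruct (2 ^ i =? 2 ^ j)%nat.
- rewrite <- (Rmult_0_r (q ^ j)), <- K. apply Series_ext. intros i.
  rewrite H2_coef_monomial. now destruct (2 ^ i =? 2 ^ j)%nat.
Qed.

End Lacunary.

(** The sum is split at J: below J the growing bound L p^j gives a geometric sum dominated by p^J,
    and from J on the uniform bound B is summed against the decaying q^j. *)
Lemma lacunary_sum_le (q p B L : R) (m : nat -> R) J n : 0 < q < 1 -> 1 < p -> 0 <= B -> 0 <= L ->
  (forall j, q ^ j * m j <= L * p ^ j) -> (forall j, m j <= B) ->
  sum_n (fun j => q ^ j * m j) n <= L * p ^ J / (p - 1) + B * q ^ J / (1 - q).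
Proof.
intros Hq Hp HB HL H1 H2.
(* Minimum and maximum with J let one induction cover the indices before and after the split. *)
assert (K : sum_n (fun j => q ^ j * m j) n <=
  L * p ^ Nat.min (S n) J / (p - 1) + B * (q ^ J - q ^ Nat.max (S n) J) / (1 - q)).
{ assert (Step : forall n s,
    s <= L * p ^ Nat.min n J / (p - 1) + B * (q ^ J - q ^ Nat.max n J) / (1 - q) ->
    s + q ^ n * m n <= L * p ^ Nat.min (S n) J / (p - 1)
      + B * (q ^ J - q ^ Nat.max (S n) J) / (1 - q)).
  { intros k s Hs. destruct (Nat.lt_ge_cases k J).
    - rewrite !Nat.min_l, !Nat.max_r in * by lia. specialize (H1 k).
      replace (L * p ^ S k / (p - 1)) with (L * p ^ k / (p - 1) + L * p ^ k)
        by (simpl; field; lra). lra.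
    - rewrite !Nat.min_r, !Nat.max_l in * by lia. specialize (H2 k).
      replace (B * (q ^ J - q ^ S k) / (1 - q))
        with (B * (q ^ J - q ^ k) / (1 - q) + q ^ k * B) by (simpl; field; lra).
      assert (q ^ k * m k <= q ^ k * B) by (apply Rmult_le_compat_l; [apply pow_le; lra|lra]).
      lra. }
  induction n as [|n IH].
  - rewrite sum_O. rewrite <- (Rplus_0_l (q ^ 0 * m 0%nat)). apply Step.
    rewrite Nat.min_0_l, Nat.max_0_l, Rminus_diag, Rmult_0_r.
    unfold Rdiv. rewrite Rmult_0_l, Rplus_0_r, pow_O, Rmult_1_r.
    apply Rmult_le_pos; [exact HL|left; apply Rinv_0_lt_compat; lra].
  - rewrite sum_Sn. apply Step, IH. }
apply Rle_trans with (1 := K). unfold Rdiv.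
assert (0 < / (p - 1)) by (apply Rinv_0_lt_compat; lra).
assert (0 < / (1 - q)) by (apply Rinv_0_lt_compat; lra).
apply Rplus_le_compat; apply Rmult_le_compat_r; try lra; apply Rmult_le_compat_l; try lra.
- apply Rle_pow; [lra|lia].
- pose proof (pow_le q (Nat.max (S n) J) ltac:(lra)). lra.
Qed.

(** J is the first exponent with 2^J > y; the preceding power is at most y, whence 2^J <= 2y. *)
Lemma dyadic_scale (y : R) : 1 <= y -> exists J, y < 2 ^ J <= 2 * y.
Proof.
intros Hy.
assert (K : forall n, y < 2 ^ n -> exists J, y < 2 ^ J <= 2 * y).
{ induction n as [|n IH]; intros H; [simpl in H; lra|].
  destruct (Rlt_le_dec y (2 ^ n)) as [L|L]; [auto|].
  exists (S n). simpl in *. lra. }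
destruct (Pow_x_infinity 2 ltac:(rewrite Rabs_right; lra) (y + 1)) as [n Hn].
apply (K n). specialize (Hn n (le_n _)).
rewrite Rabs_right in Hn by (apply Rle_ge, pow_le; lra). lra.
Qed.

(** * The lacunary functional at the critical decay rate *)

Section Counterexample.

Context (alpha : R) (Halpha : 0 < alpha < 1).

(** Critical choice: q^{2j} (2^j)^alpha = 1. The companion p = q sqrt 2 is the growth rate of q^j
    sqrt(2^j). *)
Let q := Rpower 2 (- (alpha / 2)).
Let p := Rpower 2 ((1 - alpha) / 2).

Lemma lacunary_ratio_bounds : 0 < q < 1.
Proof.
unfold q. split; [apply exp_pos|]. rewrite <- (Rpower_O 2) by lra. apply Rpower_lt; lra.
Qed.

Lemma lacunary_growth_gt_1 : 1 < p.
Proof. unfold p. rewrite <- (Rpower_O 2) at 1 by lra. apply Rpower_lt; lra. Qed.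

Lemma lacunary_growth_eq : q * sqrt 2 = p.
Proof.
unfold q, p. rewrite <- Rpower_sqrt, <- Rpower_plus by lra. f_equal. field.
Qed.

Lemma geom_partial_le (x : R) n : 0 <= x <= 1 -> sum_n (fun k => x ^ k) n <= INR (S n).
Proof.
intros Hx. apply Rle_trans with (sum_n (fun _ => 1) n).
- apply sum_n_le. intros k _. rewrite <- (pow1 k). apply pow_incr, Hx.
- rewrite sum_n_const, Rmult_1_r. lra.
Qed.

(** With d = 1 - |w|^2, the coefficient of index 2^j is at most |f| times 2 sqrt(2)^j and at most
    |f| times d^{-1/2}. Splitting where 2^J is about 1/d makes both parts of the sum of order
    d^{-(1-alpha)/2}. The 4 is the product of this 2 and the loss 2 in [E1]. *)
Lemma lacunary_resolvent_le (w : C) (f : H2) : Cmod w < 1 ->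
  Cmod (lacunary q (disc_resolvent shift w f))
  <= 2 * (4 / (p - 1) + 1 / (1 - q))
     * Rpower (1 - Cmod w ^ 2) (- ((1 - alpha) / 2)) * norm f.
Proof.
intros Hw. pose proof (Cmod_ge_0 w) as Hw0. pose proof (norm_ge_0 f) as Hf.
pose proof lacunary_ratio_bounds as Hq. pose proof lacunary_growth_gt_1 as Hp.
set (x := Cmod w ^ 2). assert (Hx : 0 <= x < 1) by (unfold x; split; simpl; nra).
set (d := 1 - x). assert (Hd : 0 < d <= 1) by (unfold d; lra).
assert (Hd' : 1 <= / d) by (rewrite <- Rinv_1; apply Rinv_le_contravar; lra).
destruct (dyadic_scale (/ d) Hd') as [J [J1 J2]].
set (m := fun j => sqrt (sum_n (fun k => x ^ k) (2 ^ j)) * norm f).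
rewrite !Rmult_assoc.
apply (Cmod_lacunary_le q Hq _ m).
{ intros j. exact (Cmod_H2_coef_resolvent_le w f (2 ^ j) Hw). }
intros n.
apply Rle_trans with (2 * norm f * p ^ J / (p - 1) + / sqrt d * norm f * q ^ J / (1 - q)).
- apply lacunary_sum_le; try lra.
  + apply Rmult_le_pos; [left; apply Rinv_0_lt_compat, sqrt_lt_R0; lra|exact Hf].
  + intros j. unfold m.
    rewrite <- lacunary_growth_eq, Rpow_mult_distr.
    replace (2 * norm f * (q ^ j * sqrt 2 ^ j)) with (q ^ j * (2 * sqrt 2 ^ j * norm f)) by ring.
    apply Rmult_le_compat_l; [apply pow_le; lra|].
    apply Rmult_le_compat_r; [exact Hf|].
    assert (S0 : 0 <= 2 * sqrt 2 ^ j).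
    { apply Rmult_le_pos; [lra|apply pow_le, sqrt_pos]. }
    rewrite <- (sqrt_pow2 (2 * sqrt 2 ^ j)) by exact S0.
    apply sqrt_le_1_alt.
    apply Rle_trans with (1 := geom_partial_le x (2 ^ j) ltac:(lra)).
    rewrite S_INR, pow_INR, Rpow_mult_distr, <- pow_mult, Nat.mul_comm, pow_mult, pow2_sqrt by lra.
    change (INR 2) with 2. pose proof (pow_R1_Rle 2 j ltac:(lra)). lra.
  + intros j. unfold m. apply Rmult_le_compat_r; [exact Hf|].
    rewrite <- sqrt_inv. apply sqrt_le_1_alt. unfold d. apply geom_sum_n_le. lra.
(* From 2^J <= 2/d; the factor 2^{(1-alpha)/2} is rounded up to 2. *)
- assert (E1 : p ^ J <= 2 * Rpower d (- ((1 - alpha) / 2))).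
  { unfold p. rewrite <- Rpower_pow_l by lra.
    apply Rle_trans with (Rpower (2 * / d) ((1 - alpha) / 2)).
    - apply Rle_Rpower_l; [lra|]. split; [apply pow_lt; lra|lra].
    - rewrite <- Rpower_mult_distr by lra. rewrite Rpower_Ropp.
      replace (Rpower (/ d) ((1 - alpha) / 2)) with (/ Rpower d ((1 - alpha) / 2)).
      + apply Rmult_le_compat_r; [left; apply Rinv_0_lt_compat, exp_pos|].
        apply Rle_trans with (Rpower 2 1); [apply Rle_Rpower; lra|rewrite Rpower_1; lra].
      + rewrite <- Rpower_Ropp. unfold Rpower. rewrite ln_Rinv by lra. f_equal. ring. }
  (* From 2^J > 1/d, which gives q^J <= d^{alpha/2}. *)
  assert (E2 : / sqrt d * q ^ J <= Rpower d (- ((1 - alpha) / 2))).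
  { replace (- ((1 - alpha) / 2)) with (- / 2 + alpha / 2) by field.
    rewrite Rpower_plus, Rpower_Ropp, Rpower_sqrt by lra.
    apply Rmult_le_compat_l; [left; apply Rinv_0_lt_compat, sqrt_lt_R0; lra|].
    unfold q. rewrite <- Rpower_pow_l, Rpower_Ropp by lra.
    rewrite <- (Rinv_inv (Rpower d (alpha / 2))).
    apply Rinv_le_contravar; [apply Rinv_0_lt_compat, exp_pos|].
    rewrite <- Rpower_Ropp.
    replace (Rpower d (- (alpha / 2))) with (Rpower (/ d) (alpha / 2)).
    - apply Rle_Rpower_l; lra.
    - unfold Rpower. rewrite ln_Rinv by lra. f_equal. ring. }
  set (D := Rpower d _) in *.
  assert (0 < / (p - 1)) by (apply Rinv_0_lt_compat; lra).
  assert (0 < / (1 - q)) by (apply Rinv_0_lt_compat; lra).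
  replace ((4 / (p - 1) + 1 / (1 - q)) * (D * norm f))
    with (2 * norm f * (2 * D) * / (p - 1) + norm f * D * / (1 - q)) by (field; lra).
  unfold Rdiv. apply Rplus_le_compat; (apply Rmult_le_compat_r; [lra|]).
  + apply Rmult_le_compat_l; lra.
  + replace (/ sqrt d * norm f * q ^ J) with (norm f * (/ sqrt d * q ^ J)) by ring.
    apply Rmult_le_compat_l; lra.
Qed.

Lemma lacunary_resolvent_condition : resolvent_condition alpha shift (lacunary q).
Proof.
unfold resolvent_condition.
set (E := fun r : R => _).
set (A := 2 * (4 / (p - 1) + 1 / (1 - q))).
destruct (Lub_Rbar_correct E) as [_ L].
apply Rbar_le_lt_trans with (Finite A); [|exact I]. apply L.
intros r [w [Hw ->]]. cbv [Rbar_le].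
assert (Hx : 0 < 1 - Cmod w ^ 2) by (pose proof (Cmod_ge_0 w); simpl; nra).
destruct (shift_disc_resolvent Hw) as [RL _].
assert (LD : is_linear (fun f => lacunary q (disc_resolvent shift w f)))
  by exact (is_linear_comp _ _ RL (is_linear_lacunary q lacunary_ratio_bounds)).
destruct (dual_norm_is_lub LD) as [_ U].
set (D := dual_norm _) in *.
assert (HD : D <= A * Rpower (1 - Cmod w ^ 2) (- ((1 - alpha) / 2))).
{ apply (U (Finite _)). intros s [f [Hf ->]]. simpl Rbar_le.
  apply Rle_trans with (1 := lacunary_resolvent_le w f Hw). fold A.
  set (P := Rpower _ _). assert (0 < P) by apply exp_pos.
  assert (0 < A).
  { pose proof lacunary_ratio_bounds. pose proof lacunary_growth_gt_1.
    assert (0 < 4 / (p - 1)) by (apply Rdiv_lt_0_compat; lra).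
    assert (0 < 1 / (1 - q)) by (apply Rdiv_lt_0_compat; lra). unfold A. lra. }
  assert (0 < A * P) by (apply Rmult_lt_0_compat; assumption).
  pose proof (norm_ge_0 f). change (Hierarchy.norm f) with (norm f). nra. }
apply (Rmult_le_compat_l (Rpower (1 - Cmod w ^ 2) ((1 - alpha) / 2))) in HD;
  [|left; apply exp_pos].
rewrite Rpower_Ropp in HD.
set (P := Rpower (1 - _) _) in *. assert (0 < P) by apply exp_pos.
replace (P * (A * / P)) with A in HD by (field; lra). exact HD.
Qed.

(** For x = 1 even convergence fails: at index 2^N the weight (1 + 2^N)^alpha outweighs q^{2N} =
    2^{-N alpha}, so the terms do not tend to 0. *)
Lemma lacunary_not_admissible : ~ discrete_admissible alpha shift (lacunary q).
Proof.
intros [M [_ H]]. destruct (H H2_one) as [Hs _].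
apply ex_series_lim_0, is_lim_seq_spec in Hs.
destruct (Hs (mkposreal 1 Rlt_0_1)) as [N HN]. simpl in HN.
(* Terms past N would be below 1; the index 2^N >= N lies past N and is one that the functional
   sees. *)
specialize (HN (2 ^ N)%nat (Nat.lt_le_incl _ _ (Nat.pow_gt_lin_r 2 N ltac:(lia)))).
change (Nat.iter (2 ^ N) shift H2_one) with (monomial (2 ^ N)) in HN.
rewrite (lacunary_monomial q) in HN.
pose proof lacunary_ratio_bounds as Hq.
rewrite Cmod_R, (Rabs_right (q ^ N)) in HN by (apply Rle_ge, pow_le; lra).
assert (K : 1 <= Rpower (1 + INR (2 ^ N)) alpha * (q ^ N) ^ 2).
{ rewrite pow_INR. change (INR 2) with 2.
  replace 1 with (Rpower (2 ^ N) alpha * (q ^ N) ^ 2) at 1.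
  - apply Rmult_le_compat_r; [apply pow2_ge_0|]. apply Rle_Rpower_l; [lra|].
    pose proof (pow_lt 2 N ltac:(lra)). lra.
  - unfold q. rewrite <- Rpower_pow_l, <- Rsqr_pow2 by lra. unfold Rsqr.
    rewrite <- !Rpower_plus.
    replace (alpha + (- (alpha / 2) + - (alpha / 2))) with 0 by field.
    apply Rpower_O, pow_lt. lra. }
rewrite Rminus_0_r, Rabs_right in HN; lra.
Qed.

End Counterexample.

Theorem theorem3p8 : forall alpha : R, 0 < alpha < 1 ->
  (forall c : H2 -> C, is_linear c -> resolvent_condition alpha shift c ->
     forall beta : R, 0 <= beta < alpha -> discrete_admissible beta shift c) /\
  (exists c : H2 -> C, is_linear c /\ resolvent_condition alpha shift c /\
     ~ discrete_admissible alpha shift c).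
Proof.
intros alpha Ha. split.
- intros c Hc Hr beta Hb.
  exact (resolvent_condition_admissible alpha beta c Hb (proj2 Ha) Hc Hr).
- exists (lacunary (Rpower 2 (- (alpha / 2)))). split; [|split].
  + exact (is_linear_lacunary _ (lacunary_ratio_bounds alpha Ha)).
  + exact (lacunary_resolvent_condition alpha Ha).
  + exact (lacunary_not_admissible alpha Ha).
Qed.
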